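(* Let $G$ be a finitely generated, torsion-free, commutative transitive group. Let $\mathcal{E}$ be the set of infinite cyclic subgroups of $G$, and let $\sim$ be the commensurability relation on $\mathcal{E}$. Let $T$ be a tree with infinite cyclic edge stabilizers, such that all solvable Baumslag–Solitar subgroups of $G$ (subgroups isomorphic to some $BS(1,s)$, $s\neq0$) are elliptic in $T$. Then $T_c^*$, $T_c$ and $T$ lie in the same deformation space, and $T_c^*$ is $2$-acylindrical.
   Context: $G$ is commutative transitive if centralizers of non-trivial elements are abelian. $BS(1,s)=\langle a,t\mid tat^{-1}=a^s\rangle$ for $s\ne0$; in particular $BS(1,1)=\mathbb{Z}^2$. Subgroups $A,B$ are commensurable if $A\cap B$ has finite index in both. A tree is a simplicial tree with an action of $G$ without inversions; $G_e$ is the stabilizer of an edge $e$. A subgroup is elliptic in a tree if it fixes a point. Two trees are in the same deformation space if they have the same elliptic subgroups. A tree is $k$-acylindrical if the (pointwise) stabilizer of any segment of length $>k$ is trivial. Tree of cylinders. Declare two edges $e,e'$ of $T$ equivalent if $G_e\sim G_{e'}$. A cylinder of $T$ is an equivalence class $Y$ of edges, identified with the union of its edges; cylinders are subtrees of $T$ and two distinct cylinders meet in at most one point. $T_c$ is the bipartite tree with vertex set $V_0(T_c)\sqcup V_1(T_c)$, where $V_0(T_c)$ is the set of vertices of $T$ belonging to at least two distinct cylinders, $V_1(T_c)$ is the set of cylinders of $T$, and there is an edge $(x,Y)$ between $x\in V_0(T_c)$ and $Y\in V_1(T_c)$ if and only if $x\in Y$. It carries the induced $G$-action. If $T$ is a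 single point, $T_c$ is understood to be a point. The collapsed tree of cylinders $T_c^*$ is obtained from $T_c$ by collapsing (each to a point) all edges whose stabilizer is not in $\mathcal{E}$. *)

(* Defs.v *)
From HB Require Import structures.
From mathcomp Require Import all_boot order ssralg ssrnum ssrint.
From mathcomp Require Import boolp classical_sets functions cardinality.

Set Implicit Arguments.
Unset Strict Implicit.
Unset Printing Implicit Defensive.

Local Open Scope classical_set_scope.
Local Open Scope group_scope.

Section Groups.
Variable G : groupType.
Implicit Types (H K : set G) (A : set G).

Definition subgroup H : Prop := group_closed [in H].

Definition generated A : set G := smallest subgroup A.

Definition finitely_generated : Prop :=
  exists s : seq G, generated [set` s] = setT.

Definition torsion_free : Prop :=
  forall (g : G) (n : nat), (0 < n)%N -> g ^+ n = 1 -> g = 1.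

Definition centralizer (g : G) : set G := [set x | commute x g].

Definition commutative_transitive : Prop :=
  forall g : G, g <> 1 ->
    {in centralizer g &, forall x y, commute x y}.

Definition infinite_cyclic H : Prop :=
  infinite_set H /\ exists g, H = generated [set g].

(* Meant for a subgroup H of K: the set of left cosets xH, x in K, is finite. *)
Definition finite_index H K : Prop :=
  finite_set [set [set x * h | h in H] | x in K].

Definition commensurable H K : Prop :=
  finite_index (H `&` K) H /\ finite_index (H `&` K) K.

End Groups.

(* The group < X | R >. A word is a sequence of letters (x, b), where b = true *)
(* stands for x^-1; a pair in R is a relation u = v between words.             *)
Section Presentation.
Variables (X : choiceType) (R : set (seq (X * bool) * seq (X * bool))).
Local Notation word := (seq (X * bool)).
Implicit Types u v w : word.

Inductive word_eq : word -> word -> Prop :=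
| word_eq_refl w : word_eq w w
| word_eq_sym v w : word_eq v w -> word_eq w v
| word_eq_trans u v w : word_eq u v -> word_eq v w -> word_eq u w
| word_eq_cat u u' v v' : word_eq u u' -> word_eq v v' ->
    word_eq (u ++ v) (u' ++ v')
| word_eq_cancel x b : word_eq [:: (x, b); (x, ~~ b)] [::]
| word_eq_rel u v : R (u, v) -> word_eq u v.

Definition word_eqb : rel word := fun u v => `[< word_eq u v >].

Lemma word_eqb_refl : reflexive word_eqb.
Proof. by move=> w; apply/asboolP; apply: word_eq_refl. Qed.

Lemma word_eqb_sym : symmetric word_eqb.
Proof. by move=> u v; apply/asboolP/asboolP; apply: word_eq_sym. Qed.

Lemma word_eqb_trans : transitive word_eqb.
Proof.
move=> v u w /asboolP uv /asboolP vw; apply/asboolP; exact: word_eq_trans uv vw.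
Qed.

Canonical word_eqb_equiv :=
  EquivRel word_eqb word_eqb_refl word_eqb_sym word_eqb_trans.

Local Open Scope quotient_scope.

Definition presented_group : Type := {eq_quot word_eqb}.
HB.instance Definition _ := Choice.on presented_group.
HB.instance Definition _ := EqQuotient.on presented_group.

Definition word_inv w : word := rev [seq (l.1, ~~ l.2) | l <- w].

Definition pg_of (w : word) : presented_group := \pi_presented_group w.
Definition pg_mul (x y : presented_group) := pg_of (repr x ++ repr y).
Definition pg_inv (x : presented_group) := pg_of (word_inv (repr x)).

Lemma pg_ofP u v : pg_of u = pg_of v <-> word_eq u v.
Proof.
rewrite /pg_of; split; first by move=> /eqmodP /asboolP.
by move=> uv; apply/eqmodP/asboolP.
Qed.

Lemma pg_of_repr x : pg_of (repr x) = x.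
Proof. exact: reprK. Qed.

Lemma repr_pg_of w : word_eq (repr (pg_of w)) w.
Proof. by apply/pg_ofP; rewrite pg_of_repr. Qed.

Lemma pg_of_cat u v : pg_of (u ++ v) = pg_mul (pg_of u) (pg_of v).
Proof.
by apply/pg_ofP/word_eq_sym/word_eq_cat; apply: repr_pg_of.
Qed.

Lemma word_invV w : word_eq (word_inv w ++ w) [::].
Proof.
elim: w => [|[x b] w IHw]; first exact: word_eq_refl.
rewrite /word_inv /= rev_cons cat_rcons -/(word_inv w).
apply: word_eq_trans IHw; apply: word_eq_cat; first exact: word_eq_refl.
rewrite -[w in X in word_eq _ X]cat0s -cat1s -[X in word_eq X]/([:: _; _] ++ w).
apply: word_eq_cat; last exact: word_eq_refl.
by have := word_eq_cancel x (~~ b); rewrite negbK.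
Qed.

Lemma word_invK w : word_inv (word_inv w) = w.
Proof.
rewrite /word_inv map_rev revK -map_comp -[RHS]map_id.
by apply: eq_map => -[x b]; rewrite /= negbK.
Qed.

Lemma pg_mulA : associative pg_mul.
Proof.
move=> x y z; rewrite -[x]pg_of_repr -[y]pg_of_repr -[z]pg_of_repr.
by rewrite -!pg_of_cat catA.
Qed.

Lemma pg_mul1 : left_id (pg_of [::]) pg_mul.
Proof. by move=> x; rewrite -[x in LHS]pg_of_repr -pg_of_cat pg_of_repr. Qed.

Lemma pg_mulr1 : right_id (pg_of [::]) pg_mul.
Proof.
by move=> x; rewrite -[x in LHS]pg_of_repr -pg_of_cat cats0 pg_of_repr.
Qed.

Lemma pg_mulV : left_inverse (pg_of [::]) pg_inv pg_mul.
Proof.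
move=> x; rewrite -[x in X in pg_mul _ X]pg_of_repr -pg_of_cat.
exact/pg_ofP/word_invV.
Qed.

Lemma pg_mulrV : right_inverse (pg_of [::]) pg_inv pg_mul.
Proof.
move=> x; rewrite -[x in X in pg_mul X]pg_of_repr -pg_of_cat.
by apply/pg_ofP; have := word_invV (word_inv (repr x)); rewrite word_invK.
Qed.

HB.instance Definition _ := isGroup.Build presented_group
  pg_mulA pg_mul1 pg_mulr1 pg_mulV pg_mulrV.

End Presentation.

(* BS(1,s) = < a, t | t a t^-1 = a^s >, with the letters a = false, t = true. *)
Definition BS_relation (s : int) :
    set (seq (bool * bool) * seq (bool * bool)) :=
  [set ([:: (true, false); (false, false); (true, true)],
        nseq `|s|%N (false, (s < 0)%R))].

Definition BS (s : int) : groupType := presented_group (BS_relation s).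

Definition solvable_BS_subgroup (G : groupType) (K : set G) : Prop :=
  exists2 s : int, s <> 0%R &
    exists f : BS s -> G,
      [/\ {morph f : x y / x * y}, injective f & range f = K].

(* A simple graph with an action of G by automorphisms. *)
Record ggraph (G : groupType) := GGraph {
  vert :> choiceType;
  adj : rel vert;
  act : G -> vert -> vert;
  adj_sym : symmetric adj;
  adj_irr : irreflexive adj;
  act1 : forall x, act 1 x = x;
  actM : forall g h x, act (g * h) x = act g (act h x);
  act_adj : forall g x y, adj (act g x) (act g y) = adj x y
}.
Arguments adj {G} T : rename.
Arguments act {G T} : rename.

Section GGraphs.
Variable G : groupType.
Implicit Types (T : ggraph G) (H : set G).

Definition is_tree T : Prop :=
  [/\ inhabited T,
      forall x y : T, exists2 p, path (adj T) x p & last x p = y,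
      forall c : seq T, (2 < size c)%N -> ~ ucycle (adj T) c
    & forall (g : G) (x y : T), adj T x y -> ~ (act g x = y /\ act g y = x)].

Definition fixer T (A : set T) : set G :=
  [set g | forall x, A x -> act g x = x].

(* An edge is the set of its two endpoints. In the absence of inversions the *)
(* stabilizer G_e of e is [fixer e].                                         *)
Definition edge T : set (set T) :=
  [set e | exists x y : T, adj T x y /\ e = [set x; y]].

(* An automorphism without inversions fixing a point of the geometric *)
(* realization fixes a vertex.                                        *)
Definition elliptic T H : Prop := exists x : T, H `<=` fixer [set x].

Definition same_deformation_space T T' : Prop :=
  [/\ is_tree T, is_tree T' &
      forall H, subgroup H -> (elliptic T H <-> elliptic T' H)].

(* In a tree, the segments between vertices are the paths without repetition, *)
(* [size p] being the number of edges. Segments with arbitrary endpoints give *)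
(* the same notion, since fixing an interior point of an edge amounts to      *)
(* fixing the whole edge.                                                     *)
Definition acylindrical (k : nat) T : Prop :=
  forall (x : T) (p : seq T), path (adj T) x p -> uniq (x :: p) ->
    (k < size p)%N -> fixer [set` x :: p] = [set 1].

End GGraphs.
Arguments edge {G} T.

Section ActFacts.
Variables (G : groupType) (T : ggraph G).
Implicit Types (g h : G) (x y : T) (A e : set T).

Lemma actK g : cancel (@act G T g) (act g^-1).
Proof. by move=> x; rewrite -actM mulVg act1. Qed.

Lemma actVK g : cancel (@act G T g^-1) (act g).
Proof. by move=> x; rewrite -actM mulgV act1. Qed.

Lemma image_act1 (A : set T) : act 1 @` A = A.
Proof.
by apply/seteqP; split=> [_ [x Ax <-]|x Ax]; [rewrite act1|exists x; rewrite ?act1].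
Qed.

Lemma image_actM g h A : act (g * h) @` A = act g @` (act h @` A).
Proof.
by rewrite image_comp; congr image; apply/funext => x; rewrite /= actM.
Qed.

Definition act_sets g (Y : set (set T)) : set (set T) :=
  [set act g @` A | A in Y].

Lemma act_sets1 (Y : set (set T)) : act_sets 1 Y = Y.
Proof.
by apply/seteqP; split=> [_ [A YA <-]|A YA]; [|exists A => //]; rewrite image_act1.
Qed.

Lemma act_setsM g h (Y : set (set T)) :
  act_sets (g * h) Y = act_sets g (act_sets h Y).
Proof.
by rewrite /act_sets image_comp; congr image; apply/funext => A; rewrite /= image_actM.
Qed.

Lemma image_actK g A : act g^-1 @` (act g @` A) = A.
Proof. by rewrite -image_actM mulVg image_act1. Qed.

Lemma image_actVK g A : act g @` (act g^-1 @` A) = A.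
Proof. by rewrite -image_actM mulgV image_act1. Qed.

Lemma edge_act g e : edge T e -> edge T (act g @` e).
Proof.
move=> [x [y [xy ->]]]; exists (act g x), (act g y); split.
  by rewrite act_adj.
by rewrite image_setU !image_set1.
Qed.

Lemma fixer_act g A :
  fixer (act g @` A) = [set g * h * g^-1 | h in fixer A].
Proof.
apply/seteqP; split=> [k fk|_ [h fh <-] _ [x Ax <-]]; last first.
  by rewrite -actM mulgVK actM fh.
exists (g^-1 * k * g); last by rewrite !mulgA mulgV mul1g mulgK.
by move=> x Ax; rewrite !actM fk ?actK//; exists x.
Qed.

End ActFacts.

Section ConjFacts.
Variable G : groupType.
Implicit Types (g : G) (H K : set G).

Definition conjs g H : set G := [set g * h * g^-1 | h in H].

Lemma conjs_inj g : injective (fun h : G => g * h * g^-1).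
Proof. by move=> h k /mulIg /mulgI. Qed.

Lemma finite_index_conjs g H K :
  finite_index H K -> finite_index (conjs g H) (conjs g K).
Proof.
move=> /(finite_image (conjs g)); apply: sub_finite_set.
move=> _ [_ [x Kx <-] <-]; exists [set x * h | h in H]; first by exists x.
apply/seteqP; split=> [_ [_ [h Hh <-] <-]|_ [_ [h Hh <-] <-]].
  exists (g * h * g^-1); first by exists h.
  by rewrite !mulgA mulgVK.
exists (x * h); first by exists h.
by rewrite !mulgA mulgVK.
Qed.

Lemma conjsI g H K : conjs g (H `&` K) = conjs g H `&` conjs g K.
Proof.
apply/seteqP; split=> [_ [h [Hh Kh] <-]|_ [[h Hh <-] [k Kk /conjs_inj E]]].
  by split; exists h.
by exists h => //; split=> //; rewrite -E.
Qed.

Lemma commensurable_conjs g H K :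
  commensurable H K -> commensurable (conjs g H) (conjs g K).
Proof. by rewrite /commensurable -conjsI => -[? ?]; split; exact: finite_index_conjs. Qed.

Lemma generated_sub H (A : set G) : subgroup H -> A `<=` H -> generated A `<=` H.
Proof. exact: smallest_sub. Qed.

Lemma subgroup_conjs g H : subgroup H -> subgroup (conjs g H).
Proof.
move=> [H1 Hd]; split.
  by apply/mem_set; exists 1; [exact/set_mem|rewrite mulg1 mulgV].
move=> _ _ /set_mem[x Hx <-] /set_mem[y Hy <-]; apply/mem_set.
exists (x / y); first by apply/set_mem/Hd; exact/mem_set.
by rewrite !invgM invgK !mulgA mulgVK.
Qed.

Lemma conjsK g H : conjs g^-1 (conjs g H) = H.
Proof.
rewrite /conjs image_comp -[RHS]image_id; congr image; apply/funext => x /=.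
by rewrite invgK !mulgA mulVg mul1g mulgVK.
Qed.

Lemma subgroup_generated (A : set G) : subgroup (generated A).
Proof.
split; first by apply/mem_set => K [[K1 _] _]; exact/set_mem.
move=> x y /set_mem gx /set_mem gy; apply/mem_set => K [sK AK].
by apply/set_mem/sK.2; apply/mem_set; [apply: gx|apply: gy].
Qed.

Lemma conjs_generated g (A : set G) :
  conjs g (generated A) = generated (conjs g A).
Proof.
apply/seteqP; split.
  rewrite -[X in _ `<=` X](conjsK g^-1) invgK; apply: image_subset.
  apply: generated_sub; first exact/subgroup_conjs/subgroup_generated.
  rewrite -[X in X `<=` _](conjsK g); apply: image_subset.
  exact: sub_gen_smallest.
apply: generated_sub; first exact/subgroup_conjs/subgroup_generated.
by apply: image_subset; exact: sub_gen_smallest.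
Qed.

Lemma infinite_cyclic_conjs g H :
  infinite_cyclic (conjs g H) <-> infinite_cyclic H.
Proof.
have imp k K : infinite_cyclic K -> infinite_cyclic (conjs k K).
  move=> [iK [x KE]]; split.
    by apply: contra_not iK => /(finite_image (fun h => k^-1 * h * k^-1^-1));
      rewrite -/(conjs _ _) conjsK.
  by exists (k * x * k^-1); rewrite KE conjs_generated /conjs image_set1.
by split=> [/(imp g^-1)|/imp//]; rewrite conjsK.
Qed.

End ConjFacts.

Section Cylinders.
Variables (G : groupType) (T : ggraph G).
Implicit Types (g : G) (x : T) (e : set T) (Y : set (set T)).

Definition edge_class e : set (set T) :=
  [set e' | edge T e' /\ commensurable (fixer e) (fixer e')].

Definition cylinder Y : Prop := exists2 e, edge T e & Y = edge_class e.

Definition on_cylinder x Y : Prop := exists2 e, Y e & e x.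

(* The second clause encodes the convention that the tree of cylinders of a *)
(* point is a point.                                                        *)
Definition V0 x : Prop :=
  (exists Y Y', [/\ cylinder Y, cylinder Y', Y <> Y',
                    on_cylinder x Y & on_cylinder x Y'])
  \/ (forall y, y = x).

Lemma edge_class_act g e :
  act_sets g (edge_class e) = edge_class (act g @` e).
Proof.
apply/seteqP; split=> [_ [e' [ee' ce'] <-]|e' [ee' ce']].
  split; first exact: edge_act.
  by rewrite !fixer_act; exact: commensurable_conjs.
exists (act g^-1 @` e'); last by rewrite image_actVK.
split; first exact: edge_act.
rewrite -[e in fixer e](image_actK g) ![fixer (act g^-1 @` _)]fixer_act.
exact: commensurable_conjs.
Qed.

Lemma cylinder_act g Y : cylinder Y -> cylinder (act_sets g Y).
Proof.
move=> [e ee ->]; exists (act g @` e); first exact: edge_act.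
exact: edge_class_act.
Qed.

Lemma on_cylinder_act g x Y :
  on_cylinder x Y -> on_cylinder (act g x) (act_sets g Y).
Proof. by move=> [e Ye ex]; exists (act g @` e); [exists e|exists x]. Qed.

Lemma act_sets_inj g : injective (@act_sets G T g).
Proof.
move=> Y Y' /= E.
by rewrite -[Y]act_sets1 -[Y']act_sets1 -(mulVg g) !act_setsM E.
Qed.

Lemma on_cylinder_actE g x Y :
  on_cylinder (act g x) (act_sets g Y) <-> on_cylinder x Y.
Proof.
split=> [/(on_cylinder_act g^-1)|]; last exact: on_cylinder_act.
by rewrite actK -act_setsM mulVg act_sets1.
Qed.

Lemma V0_act g x : V0 x -> V0 (act g x).
Proof.
move=> [[Y [Y' [cY cY' YY' xY xY']]]|xT]; last first.
  by right=> y; rewrite -[y](actVK g) [act g^-1 y]xT.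
left; exists (act_sets g Y), (act_sets g Y'); split.
- exact: cylinder_act.
- exact: cylinder_act.
- by move=> /act_sets_inj.
- exact: on_cylinder_act.
- exact: on_cylinder_act.
Qed.

Definition Tc_vert : choiceType :=
  ({x : T | `[< V0 x >]} + {Y : set (set T) | `[< cylinder Y >]})%type.

Definition Tc_adj (a b : Tc_vert) : bool :=
  match a, b with
  | inl x, inr Y | inr Y, inl x => `[< on_cylinder (val x) (val Y) >]
  | _, _ => false
  end.

Lemma V0_act_subproof g (x : {x : T | `[< V0 x >]}) :
  `[< V0 (act g (val x)) >].
Proof. by apply/asboolP/V0_act/asboolP/(valP x). Qed.

Lemma cylinder_act_subproof g (Y : {Y : set (set T) | `[< cylinder Y >]}) :
  `[< cylinder (act_sets g (val Y)) >].
Proof. by apply/asboolP/cylinder_act/asboolP/(valP Y). Qed.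

Definition Tc_act g (a : Tc_vert) : Tc_vert :=
  match a with
  | inl x => inl (exist (fun x => `[< V0 x >]) _ (V0_act_subproof g x))
  | inr Y => inr (exist (fun Y => `[< cylinder Y >]) _ (cylinder_act_subproof g Y))
  end.

Lemma Tc_adj_sym : symmetric Tc_adj.
Proof. by case=> [x|Y] [y|Z]. Qed.

Lemma Tc_adj_irr : irreflexive Tc_adj.
Proof. by case. Qed.

Lemma Tc_act1 a : Tc_act 1 a = a.
Proof.
by case: a => [x|Y] /=; congr (_ _); apply: val_inj; rewrite /= ?act1 ?act_sets1.
Qed.

Lemma Tc_actM g h a : Tc_act (g * h) a = Tc_act g (Tc_act h a).
Proof.
by case: a => [x|Y] /=; congr (_ _); apply: val_inj; rewrite /= ?actM ?act_setsM.
Qed.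

Lemma Tc_act_adj g a b : Tc_adj (Tc_act g a) (Tc_act g b) = Tc_adj a b.
Proof.
by case: a b => [x|Y] [y|Z] //=; apply/asboolP/asboolP => /on_cylinder_actE.
Qed.

Definition tree_of_cylinders : ggraph G :=
  GGraph Tc_adj_sym Tc_adj_irr Tc_act1 Tc_actM Tc_act_adj.

End Cylinders.

(* Collapse of the edges of T whose stabilizer is not infinite cyclic. The   *)
(* vertices are the connected components of the union of the collapsed edges *)
(* and of the vertices of T, viewed as sets of vertices of T. Two of them    *)
(* are adjacent when some edge of T joins them; if T is a tree there is only *)
(* one such edge, and it is not collapsed.                                   *)
Section Collapse.
Variables (G : groupType) (T : ggraph G).
Implicit Types (g : G) (x y : T) (A : set T).

Definition collapsed : rel T :=
  fun x y => adj T x y && `[< ~ infinite_cyclic (fixer [set x; y]) >].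

Definition component x : set T :=
  [set y | exists2 p, path collapsed x p & last x p = y].

Definition is_component A : Prop := exists x, A = component x.

Lemma collapsed_act g x y : collapsed (act g x) (act g y) = collapsed x y.
Proof.
rewrite /collapsed act_adj; congr (_ && _); apply/asbool_equiv_eq.
have -> : [set act g x; act g y] = act g @` [set x; y].
  by rewrite image_setU !image_set1.
have := infinite_cyclic_conjs g (fixer [set x; y]).
by rewrite fixer_act => E; split; apply: contra_not => /E.
Qed.

Lemma component_act_sub g x : act g @` component x `<=` component (act g x).
Proof.
move=> _ [_ [p xp <-] <-]; exists (map (act g) p); last by rewrite last_map.
rewrite path_map; apply: sub_path xp => y z.
by rewrite /= collapsed_act.
Qed.

Lemma component_act g x : act g @` component x = component (act g x).
Proof.
apply/seteqP; split; first exact: component_act_sub.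
rewrite -[X in X `<=` _](image_actVK g); apply: image_subset.
by rewrite -[x in X in _ `<=` X](actK g); apply: component_act_sub.
Qed.

Lemma is_component_act g A : is_component A -> is_component (act g @` A).
Proof. by move=> [x ->]; exists (act g x); exact: component_act. Qed.

Definition collapse_vert : choiceType := {A : set T | `[< is_component A >]}.
Implicit Types C D : collapse_vert.

Definition collapse_adj C D : bool :=
  (C != D) && `[< exists x y, [/\ val C x, val D y & adj T x y] >].

Lemma is_component_act_subproof g C :
  `[< is_component (act g @` val C) >].
Proof. by apply/asboolP/is_component_act/asboolP/(valP C). Qed.

Definition collapse_act g C : collapse_vert :=
  exist (fun A => `[< is_component A >]) _ (is_component_act_subproof g C).

Lemma collapse_adj_sym : symmetric collapse_adj.
Proof.
move=> C D; rewrite /collapse_adj eq_sym; congr (_ && _).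
by apply/asboolP/asboolP => -[x [y [Cx Dy xy]]]; exists y, x; rewrite adj_sym.
Qed.

Lemma collapse_adj_irr : irreflexive collapse_adj.
Proof. by move=> C; rewrite /collapse_adj eqxx. Qed.

Lemma collapse_act1 C : collapse_act 1 C = C.
Proof. by apply: val_inj; rewrite /= image_act1. Qed.

Lemma collapse_actM g h C :
  collapse_act (g * h) C = collapse_act g (collapse_act h C).
Proof. by apply: val_inj; rewrite /= image_actM. Qed.

Lemma collapse_act_adj g C D :
  collapse_adj (collapse_act g C) (collapse_act g D) = collapse_adj C D.
Proof.
have imp h C' D' :
    collapse_adj C' D' -> collapse_adj (collapse_act h C') (collapse_act h D').
  move=> /andP[CD /asboolP[x [y [Cx Dy xy]]]]; apply/andP; split.
    apply: contra_neq CD => E.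
    by rewrite -[C']collapse_act1 -[D']collapse_act1 -(mulVg h) !collapse_actM E.
  apply/asboolP; exists (act h x), (act h y); rewrite act_adj.
  by split; [exists x|exists y|].
apply/idP/idP => [/(imp g^-1)|/imp//].
by rewrite -!collapse_actM mulVg !collapse_act1.
Qed.

Definition collapse : ggraph G :=
  GGraph collapse_adj_sym collapse_adj_irr collapse_act1 collapse_actM
    collapse_act_adj.

End Collapse.

Definition collapsed_tree_of_cylinders (G : groupType) (T : ggraph G) :
  ggraph G := collapse (tree_of_cylinders T).

(* Main.v *)
Require Import Defs.
From mathcomp Require Import all_boot.
From mathcomp Require Import boolp classical_sets.
From HB Require Import structures.
From mathcomp Require Import ssralg ssrnum ssrint.
From mathcomp Require Import functions cardinality zify.

(* The key point is that the stabilizer [G_Y] of a cylinder [Y] fixes a vertex of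
   [T]. First, [G_Y] contains no hyperbolic element: if [g] in [G_Y] translated an
   edge [e] of [Y] with [G_e = <c>], then [c] and [g^2 c g^-2] would commute, by
   commutative transitivity, hence fix a common vertex, so one of them would fix
   [g e]. Then [g] or [g^-1] conjugates [c] into [<c>], and [<c, g>] is a
   non-elliptic solvable Baumslag-Solitar group. Second, a group of elliptic
   elements without fixed vertex has elements whose fixed subtrees are arbitrarily
   far away; as [G] is finitely generated, a long segment of [Y] may be taken in
   an invariant subtree with finitely many orbits of edges, and it contains two
   edges translated by an element of [G_Y], which is therefore hyperbolic.

   Hence [T] and [T_c] have the same elliptic subgroups. An edge [(x, Y)] with
   [x] not fixed by [G_Y] has the stabilizer of an edge of [Y], so it is not
   collapsed; thus collapsed components are stars and collapsing does not change
   the elliptic subgroups. Finally, the edges [(x, Y)] of [T_c^*] fixed by a given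
   non-trivial element have commensurable stabilizers, hence the same [Y], so they
   do not contain a segment of length three. *)

Set Implicit Arguments.
Unset Strict Implicit.
Unset Printing Implicit Defensive.

(** * Distance, half-trees, convexity and projections in a tree *)

Section TreeMetric.
Context {G : groupType} {T : ggraph G}.
Hypothesis treeT : is_tree T.
Implicit Types (x y z u v p q : T) (g h : G) (S : set T).
Local Open Scope classical_set_scope.
Local Open Scope group_scope.

Definition walk (n : nat) x y : Prop :=
  exists s, [/\ path (adj T) x s, last x s = y & size s = n].

Lemma walk_ex x y : exists n, `[< walk n x y >].
Proof.
have [_ conn _ _] := treeT; have [s xs ls] := conn x y.
by exists (size s); apply/asboolP; exists s.
Qed.

Definition tree_dist x y : nat := ex_minn (walk_ex x y).
Local Notation dist := tree_dist.

Lemma dist_walk x y : walk (dist x y) x y.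
Proof. by rewrite /tree_dist; case: ex_minnP => n /asboolP. Qed.

Lemma dist_le n x y : walk n x y -> (dist x y <= n)%N.
Proof. by rewrite /tree_dist; case: ex_minnP => m _ min /asboolP/min. Qed.

Lemma distxx x : dist x x = 0%N.
Proof. by apply/eqP; rewrite -leqn0; apply: dist_le; exists [::]. Qed.

Lemma dist_eq0 x y : dist x y = 0%N -> x = y.
Proof. by move=> d0; have [[|a s] [_ /= ls ss]] := dist_walk x y; [|lia]. Qed.

Lemma dist_triangle x y z : (dist x z <= dist x y + dist y z)%N.
Proof.
have [s [xs ls <-]] := dist_walk x y; have [t [yt lt <-]] := dist_walk y z.
apply: dist_le; exists (s ++ t); split; last exact: size_cat.
  by rewrite cat_path xs ls.
by rewrite last_cat ls.
Qed.

Lemma dist_sym x y : dist x y = dist y x.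
Proof.
suff le u v : (dist u v <= dist v u)%N by apply/eqP; rewrite eqn_leq !le.
have [s [vs ls <-]] := dist_walk v u.
apply: dist_le; exists (rev (belast v s)); split.
- by rewrite -ls rev_path; apply: sub_path vs => a b; rewrite adj_sym.
- by case: s vs ls => [|a s] //= _ _; rewrite rev_cons last_rcons.
- by rewrite size_rev size_belast.
Qed.

Lemma dist_act g x y : dist (act g x) (act g y) = dist x y.
Proof.
have le h u v : (dist (act h u) (act h v) <= dist u v)%N.
  have [s [us ls <-]] := dist_walk u v.
  apply: dist_le; exists (map (act h) s); split; last exact: size_map.
    by rewrite path_map; apply: sub_path us => a b /=; rewrite act_adj.
  by rewrite last_map ls.
apply/eqP; rewrite eqn_leq le /=.
by rewrite -[x in (dist x y <= _)%N](actK g) -[y in (dist _ y <= _)%N](actK g) le.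
Qed.

Lemma adj_neq x y : adj T x y -> x <> y.
Proof. by move=> xy E; move: xy; rewrite E adj_irr. Qed.

Lemma adj_dist x y : adj T x y -> dist x y = 1%N.
Proof.
move=> xy; apply/eqP; rewrite eqn_leq; apply/andP; split.
  by apply: dist_le; exists [:: y]; rewrite /= xy.
by rewrite lt0n; apply/eqP => /dist_eq0; exact: adj_neq.
Qed.

Lemma dist_adj_le x y z : adj T x y -> (dist x z <= (dist y z).+1)%N.
Proof. by move=> xy; have := dist_triangle x y z; rewrite (adj_dist xy). Qed.

Lemma dist_next x z : x <> z -> exists2 y, adj T x y & dist x z = (dist y z).+1.
Proof.
move=> xz; have [[|y s] [/= ps ls ss]] := dist_walk x z; first by [].
move: ps => /andP[xy ys]; exists y => //; apply/eqP; rewrite eqn_leq.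
rewrite dist_adj_le//= -ss ltnS.
by apply: dist_le; exists s.
Qed.

(** Once shortened to have no repetition, the path from [y] to [y'] closes up through [x] to a
    cycle. *)
Lemma no_detour {x y y' s} : adj T x y -> adj T x y' -> y <> y' ->
  path (adj T) y s -> last y s = y' -> x \notin y :: s -> False.
Proof.
move=> xy xy' yy' ys; case/shortenP: ys => t yt ut sub ly xs.
have [_ _ acyc _] := treeT; apply: (acyc (x :: y :: t)).
  by case: t ly {yt ut sub} => //= E; case: yy'.
rewrite /ucycle /= rcons_path xy yt /= ly adj_sym xy' /=.
have -> : x \notin y :: t.
  apply: contra xs; rewrite !inE => /orP[->//|/sub ->].
  by rewrite orbT.
by move: ut => /=.
Qed.

(** After [y], a geodesic to [z] only meets vertices closer to [z] than [y], and [x] is not one of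
    them. *)
Lemma geodesic_avoid x y z : x <> y -> (dist y z <= dist x z)%N ->
  exists s, [/\ path (adj T) y s, last y s = z & x \notin y :: s].
Proof.
move En: (dist y z) => n; elim: n y En => [|n IHn] y En xy le.
  by exists [::]; rewrite (dist_eq0 En) in xy *; rewrite inE; split=> //; apply/eqP.
have yz : y <> z by move=> E; move: En; rewrite E distxx.
have [y1 yy1 E1] := dist_next yz.
have [|||s [ps ls xs]] := IHn y1; [lia|by move=> E; subst y1; lia|lia|].
exists (y1 :: s); split=> //=; first by rewrite yy1.
by rewrite inE negb_or xs andbT; apply/eqP.
Qed.

(** Otherwise the geodesics from [y] and [y'] to [z] both avoid [x] and form a detour. The
    inequalities are weak so that [dist_adj_neq] follows too. *)
Lemma next_uniq_le {x y y' z} : adj T x y -> adj T x y' ->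
  (dist y z <= dist x z)%N -> (dist y' z <= dist x z)%N -> y = y'.
Proof.
move=> xy xy' le le'; apply: contrapT => yy'.
have [s [ys ls xs]] := geodesic_avoid (adj_neq xy) le.
have [t [yt lt xt]] := geodesic_avoid (adj_neq xy') le'.
have := @no_detour x y y' (s ++ rev (belast y' t)) xy xy' yy'.
rewrite cat_path last_cat ys ls -lt rev_path (eq_path (fun a b => adj_sym b a)) yt.
apply=> //.
  by case: t {yt xt} lt => [|a t] //= _; rewrite rev_cons last_rcons.
rewrite -cat_cons mem_cat negb_or xs /=; apply: contra xt.
by rewrite mem_rev => /mem_belast.
Qed.

Lemma dist_adj_neq x y z : adj T x y -> dist x z <> dist y z.
Proof.
move=> xy E; have [xz|xz] := pselect (x = z).
  by move: E; rewrite -xz distxx => /esym/dist_eq0/esym; exact: adj_neq.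
have [x1 xx1 E1] := dist_next xz.
have E2 : y = x1 by apply: (@next_uniq_le x _ _ z) => //; lia.
by move: E1; rewrite -E2; lia.
Qed.

(* The half-tree at [y] of the edge [x -- y]. *)
Definition half_tree x y : set T := [set z | (dist y z < dist x z)%N].
Local Notation side := half_tree.

Lemma sideN {x y z} : adj T x y -> ~ side x y z <-> side y x z.
Proof. by move=> xy; have := dist_adj_neq (z := z) xy; rewrite /half_tree /=; lia. Qed.

Lemma sideE {x y z} : adj T x y -> side x y z -> dist x z = (dist y z).+1.
Proof. by move=> /dist_adj_le - /(_ z); rewrite /half_tree /=; lia. Qed.

Lemma side_end {x y} : adj T x y -> side x y y.
Proof. by move=> /adj_dist; rewrite /half_tree /= distxx => ->. Qed.

Lemma side_start {x y} : ~ side x y x.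
Proof. by rewrite /half_tree /= distxx. Qed.

Lemma side_act g x y z : side (act g x) (act g y) (act g z) <-> side x y z.
Proof. by rewrite /half_tree /= !dist_act. Qed.

(** If [u] were not [y], its next vertex towards [y] and the vertex [v] would both be no farther
    from [x] than [u], hence equal, against the sides on which [u] and [v] lie. *)
Lemma side_cross {x y u v} : adj T x y -> adj T u v ->
  side x y u -> ~ side x y v -> u = y /\ v = x.
Proof.
move=> xy uv hu /(sideN xy) hv; have vu : adj T v u by rewrite adj_sym.
have Eu := sideE xy hu; have Ev : dist y v = (dist x v).+1.
  by apply: sideE => //; rewrite adj_sym.
have vxu := @dist_adj_le _ _ x uv; have vxu' := @dist_adj_le _ _ x vu.
have vyu := @dist_adj_le _ _ y uv; have vyu' := @dist_adj_le _ _ y vu.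
move: Eu Ev vxu vxu' vyu vyu'; rewrite !(dist_sym x) !(dist_sym y) => Eu Ev *.
have [uy|uy] := pselect (u = y); last first.
  have [w uw Ew] := dist_next uy.
  have wx : (dist w x <= (dist w y).+1)%N.
    by have := dist_triangle w y x; rewrite (dist_sym y x) (adj_dist xy) addn1.
  have E : w = v by apply: (@next_uniq_le u _ _ x) => //; lia.
  by subst w; lia.
by subst u; split=> //; apply: dist_eq0; have := adj_dist vu; lia.
Qed.

(** Geodesic convexity, imposed only on the first step of a geodesic between points of [S];
    [convex_between] recovers the other points by induction. *)
Definition convex S : Prop :=
  forall u v y, S u -> S v -> adj T u y -> side u y v -> S y.

Lemma convex_cross {S u v x y} : convex S -> adj T x y -> S u -> S v ->
  side x y u -> ~ side x y v -> S x /\ S y.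
Proof.
move=> cS xy Su Sv hu hv.
move En: (dist u v) => n; elim: n u Su hu En => [|n IHn] u Su hu En.
  by case: hv; rewrite -(dist_eq0 En).
have [|w uw Ew] := @dist_next u v.
  by move=> E; move: En; rewrite E distxx.
have Sw : S w by apply: (cS u v) => //; rewrite /half_tree /=; lia.
have [hw|hw] := pselect (side x y w); first by apply: (IHn w) => //; lia.
by have [<- <-] := side_cross xy uw hu hw.
Qed.

Lemma side_convex x y : adj T x y -> convex (side x y).
Proof.
move=> xy u v w hu hv uw huw; apply: contrapT => hw.
have [Eu Ew] := side_cross xy uw hu hw.
by move: huw hv; rewrite Eu Ew /side /=; lia.
Qed.

Lemma convexI S S' : convex S -> convex S' -> convex (S `&` S').
Proof.
move=> cS cS' u v y [Su Su'] [Sv Sv'] uy h.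
by split; [apply: (cS u v)|apply: (cS' u v)].
Qed.

Lemma dist_sep {x y u v} : adj T x y -> side x y u -> ~ side x y v ->
  dist u v = (dist u x + dist x v)%N.
Proof.
move=> xy hu hv; move En: (dist u v) => n.
elim: n u hu En => [|n IHn] u hu En.
  by case: hv; rewrite -(dist_eq0 En).
have tri := dist_triangle u x v.
have [|w uw Ew] := @dist_next u v; first by move=> E; move: En; rewrite E distxx.
have [hw|hw] := pselect (side x y w).
  by have := IHn w hw; have := @dist_adj_le _ _ x uw; lia.
have [Eu Exw] := side_cross xy uw hu hw.
by subst u w; have := adj_dist uw; lia.
Qed.

(** Nearest-point projection of [x] to [S]. *)
Definition gate S x p : Prop := S p /\ forall q, S q -> (dist x p <= dist x q)%N.

Lemma gate_ex S x : S !=set0 -> exists p, gate S x p.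
Proof.
move=> [q0 Sq0].
have exn : exists n, `[< exists2 q, S q & dist x q = n >].
  by exists (dist x q0); apply/asboolP; exists q0.
case: (ex_minnP exn) => n /asboolP[p Sp En] min; exists p; split=> // q Sq.
by rewrite En; apply: min; apply/asboolP; exists q.
Qed.

(** The first edge from [x] towards its gate also separates [x] from [q]: otherwise convexity would
    put [x] in [S]. Induction then advances [x] along this edge. *)
Lemma gateE {S x p q} : convex S -> gate S x p -> S q ->
  dist x q = (dist x p + dist p q)%N.
Proof.
move=> cS; move En: (dist x p) => n; elim: n x En => [|n IHn] x En [Sp min] Sq.
  by rewrite (dist_eq0 En).
have [|y xy Ey] := @dist_next x p; first by move=> E; move: En; rewrite E distxx.
have yx : adj T y x by rewrite adj_sym.
have hy : side x y p by rewrite /half_tree /=; lia.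
have hq : side x y q.
  apply: contrapT => hq; have [Sx _] := convex_cross cS xy Sp Sq hy hq.
  by have := min x Sx; rewrite distxx; lia.
have Eq := sideE xy hq; rewrite (IHn y) in Eq; [lia|lia| |by []].
split=> // r Sr; have := min r Sr; have := @dist_adj_le _ _ r xy; lia.
Qed.

Lemma gate_uniq {S x p q} : convex S -> gate S x p -> gate S x q -> p = q.
Proof.
move=> cS gp [Sq minq]; have := gateE cS gp Sq; have := minq p gp.1.
by move=> ? ?; apply: dist_eq0; lia.
Qed.

Lemma gate_act g S x p : (forall y, S (act g y) <-> S y) ->
  gate S x p -> gate S (act g x) (act g p).
Proof.
move=> gS [Sp min]; split; first exact/gS.
move=> q Sq; rewrite -[q](actVK g) !dist_act; apply: min.
by apply/gS; rewrite actVK.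
Qed.

Lemma geodesic_point_uniq {x y p q} :
  (dist x y = dist x p + dist p y)%N -> (dist x y = dist x q + dist q y)%N ->
  dist x p = dist x q -> p = q.
Proof.
move En: (dist x p) => n; elim: n x En => [|n IHn] x En Ep Eq Epq.
  by rewrite -(dist_eq0 En); apply: dist_eq0.
have [|u xu Eu] := @dist_next x p; first by move=> E; move: En; rewrite E distxx.
have [|v xv Ev] := @dist_next x q; first by move=> E; move: Epq; rewrite E distxx.
have := dist_triangle u p y; have := dist_triangle v q y.
have := @dist_adj_le _ _ y xu; have := @dist_adj_le _ _ y xv => *.
have uv : u = v by apply: (@next_uniq_le x _ _ y) => //; lia.
by subst v; apply: (IHn u); lia.
Qed.

Lemma convex_between {S x y p} : convex S -> S x -> S y ->
  (dist x y = dist x p + dist p y)%N -> S p.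
Proof.
move=> cS; move En: (dist x p) => n; elim: n x En => [|n IHn] x En Sx Sy E.
  by rewrite -(dist_eq0 En).
have [|u xu Eu] := @dist_next x p; first by move=> E'; move: En; rewrite E' distxx.
have := dist_triangle u p y; have := @dist_adj_le _ _ y xu => *.
apply: (IHn u) => //; [lia| |lia].
by apply: (cS x y) => //; rewrite /half_tree /=; lia.
Qed.

Lemma iter_next x y : exists z : nat -> T,
  [/\ z 0%N = x,
      forall i, (i < dist x y)%N -> adj T (z i) (z i.+1) &
      forall i j, (i <= j <= dist x y)%N ->
        dist (z i) (z j) = (j - i)%N /\ dist (z j) y = (dist x y - j)%N].
Proof.
have nx u : {w | u <> y -> adj T u w /\ dist u y = (dist w y).+1}.
  apply: cid; have [uy|uy] := pselect (u = y); first by exists u.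
  by have [w uw Ew] := dist_next uy; exists w.
pose z i := iter i (fun u => sval (nx u)) x.
have zE i : (i <= dist x y)%N -> dist (z i) y = (dist x y - i)%N.
  elim: i => [|i IHi] lei; first by rewrite subn0.
  rewrite /z iterS -/(z i); case: (nx (z i)) => w /= H.
  have [|_ E] := H; first by move=> E; have := IHi (ltnW lei); rewrite E distxx; lia.
  by rewrite IHi in E; lia.
have zadj i : (i < dist x y)%N -> adj T (z i) (z i.+1).
  move=> lti; rewrite {2}/z iterS -/(z i); case: (nx (z i)) => w /= H.
  by have [|//] := H; move=> E; have := zE i (ltnW lti); rewrite E distxx; lia.
exists z; split=> // i j /andP[ij jn]; split; last exact: zE.
have le k : (i + k <= dist x y)%N -> (dist (z i) (z (i + k)) <= k)%N.
  elim: k => [|k IHk] lek; first by rewrite addn0 distxx.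
  have := dist_triangle (z i) (z (i + k)%N) (z (i + k.+1)%N).
  rewrite [X in (_ <= _ + X)%N]adj_dist; last by rewrite addnS; apply: zadj; lia.
  by have := IHk ltac:(lia); lia.
have := le (j - i)%N; rewrite subnKC// => /(_ jn).
have := dist_triangle (z i) (z j) y; rewrite !zE; lia.
Qed.

End TreeMetric.

(** * Fixed subtrees and translations of a group acting on a tree *)

Section TreeAction.
Context {G : groupType} {T : ggraph G}.
Hypothesis treeT : is_tree T.
Implicit Types (x y z u v p q : T) (g h k : G) (S : set T) (H : set G).
Local Open Scope classical_set_scope.
Local Open Scope group_scope.
Local Notation dist := (tree_dist treeT).
Local Notation side := (half_tree treeT).
Local Notation gate := (gate treeT).
Local Notation convex := (convex treeT).

Definition fix_set g : set T := [set p | act g p = p].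

(** An isometry fixing [u] and [v] preserves the first step from [u] towards [v], because this step
    is unique. *)
Lemma fix_convex g : convex (fix_set g).
Proof.
move=> u v y gu gv uy huy.
have E := dist_act treeT g y v; rewrite gv in E; rewrite /half_tree /= in huy.
apply: (@next_uniq_le _ _ treeT u _ _ v) => //; last by lia.
  by rewrite -[X in adj T X]gu act_adj.
by rewrite E; lia.
Qed.

(** If the geodesics from [p] to [q] and to [act g q] shared their first edge, [g] would fix its far
    end, which is closer to [q] than the gate. *)
Lemma gate_fix_between g q p : gate (fix_set g) q p ->
  dist q (act g q) = (dist q p + dist p (act g q))%N.
Proof.
move=> [gp min]; have [->|pq] := pselect (p = q); first by rewrite distxx.
have [p' pp' Ep] := dist_next treeT pq.
apply: (dist_sep (treeT := treeT) pp'); first by rewrite /half_tree /=; lia.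
move=> h'; have ngp' : act g p' <> p'.
  by move=> gp'; have := min p' gp'; rewrite !(dist_sym treeT q); lia.
apply: ngp'; apply: (@next_uniq_le _ _ treeT p _ _ (act g q)) => //.
- by rewrite -[X in adj T X]gp act_adj.
- by rewrite -[X in (_ <= tree_dist _ X _)%N]gp !dist_act; lia.
- by move: h'; rewrite /half_tree /=; lia.
Qed.

(* A point [q] with [h q = k q] makes both fixed subtrees contain the midpoint
   of [q] and [h q]. *)
Lemma common_fixed_point h k : fix_set h !=set0 -> fix_set k !=set0 ->
  fix_set (k^-1 * h) !=set0 -> exists p, act h p = p /\ act k p = p.
Proof.
move=> fh fk [q qE]; have [p gp] := gate_ex treeT q fh.
have [p' gp'] := gate_ex treeT q fk.
have hk : act h q = act k q.
  by rewrite -[in RHS]qE /fix_set actM actVK.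
have mp := gate_fix_between gp; have mp' := gate_fix_between gp'.
have [ph _] := gp; have [pk _] := gp'; rewrite /fix_set /= in ph pk.
have E : dist p (act h q) = dist q p by rewrite -[in LHS]ph dist_act dist_sym.
have E' : dist p' (act k q) = dist q p' by rewrite -[in LHS]pk dist_act dist_sym.
suff pp' : p = p' by exists p; split=> //; rewrite pp'.
rewrite hk in mp E; apply: (geodesic_point_uniq mp mp'); lia.
Qed.

Lemma fix_set_commute h k y : commute h k ->
  fix_set h (act k y) <-> fix_set h y.
Proof.
move=> hk; rewrite /fix_set /= -actM hk actM; split=> [E|->//].
by rewrite -[LHS](actK k) E actK.
Qed.

(** A fixed point of [g] projects to a fixed point in the invariant set [S], since the projection is
    unique. *)
Lemma fix_gate S g : convex S -> S !=set0 ->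
  (forall y, S (act g y) <-> S y) -> fix_set g !=set0 ->
  exists2 p, S p & act g p = p.
Proof.
move=> cS S0 gS [q gq]; have [p gp] := gate_ex treeT q S0.
have := gate_act gS gp; rewrite gq => gp'.
by exists p; [exact: gp.1|exact: (gate_uniq cS gp' gp)].
Qed.

(** The fixed subtree of [h] is invariant under [k], so a fixed point of [k] projects to a fixed
    point of [k] inside it. *)
Lemma commute_common_fixed_point h k : commute h k ->
  fix_set h !=set0 -> fix_set k !=set0 -> exists p, act h p = p /\ act k p = p.
Proof.
move=> hk fh fk.
have [p ph pk] := fix_gate (@fix_convex h) fh (fun y => fix_set_commute y hk) fk.
by exists p.
Qed.

Lemma on_geodesic x y p : (dist x y = dist x p + dist p y)%N ->
  forall z : nat -> T, z 0%N = x ->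
  (forall i j, (i <= j <= dist x y)%N ->
    dist (z i) (z j) = (j - i)%N /\ dist (z j) y = (dist x y - j)%N) ->
  p = z (dist x p).
Proof.
move=> E z z0 zE; have [] := zE 0%N (dist x p); first by rewrite /=; lia.
rewrite z0 subn0 => E1 E2.
by apply: (geodesic_point_uniq (treeT := treeT) (x := x) (y := y)); lia.
Qed.

(* Among pairwise intersecting fixed subtrees at bounded distance from [x0], a
   farthest one has its gate in all the others. *)
Lemma fixed_point_or_unbounded H x0 :
  (forall h k, H h -> H k -> exists p, act h p = p /\ act k p = p) ->
  (exists p, forall h, H h -> act h p = p) \/
  (forall n, exists2 h, H h & forall q, act h q = q -> (n <= dist x0 q)%N).
Proof.
move=> pairH; have [[h0 Hh0]|H0] := pselect (H !=set0); last first.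
  by left; exists x0 => h Hh; case: H0; exists h.
have [|bounded] := pselect (forall n, exists2 h, H h &
  forall q, act h q = q -> (n <= dist x0 q)%N); [by right|left].
have [n nP] : exists n, forall h, H h -> exists2 q, act h q = q & (dist x0 q < n)%N.
  apply: contrapT => nn; apply: bounded => n; apply: contrapT => hn.
  apply: nn; exists n => h Hh; apply: contrapT => hq; apply: hn; exists h => //.
  by move=> q qh; rewrite leqNgt; apply/negP => lt; apply: hq; exists q.
pose Q m := `[< exists h p, [/\ H h, gate (fix_set h) x0 p & dist x0 p = m] >].
have gateH h : H h -> exists p, gate (fix_set h) x0 p.
  by move=> /nP[q qh _]; apply: gate_ex; exists q.
have exQ : exists m, Q m.
  have [p gp] := gateH _ Hh0.
  by exists (dist x0 p); apply/asboolP; exists h0, p.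
have leQ m : Q m -> (m <= n)%N.
  move=> /asboolP[h [p [/nP[q qh ltq] [_ min] <-]]].
  by have := min q qh; lia.
case: (ex_maxnP exQ leQ) => m /asboolP[h [p [Hh gp Em]]] max.
exists p => k Hk; have [p' gp'] := gateH _ Hk.
have [q [qh qk]] := pairH _ _ Hh Hk.
have lep : (dist x0 p' <= m)%N by apply: max; apply/asboolP; exists k, p'.
(* Both gates lie on the geodesic from [x0] to [q], with [p'] no later than [p], so [p] lies between
   the points [p'] and [q] fixed by [k]. *)
have Ep := gateE (@fix_convex h) gp qh; have Ep' := gateE (@fix_convex k) gp' qk.
have [z [z0 _ zE]] := iter_next treeT x0 q.
have pE := on_geodesic Ep z0 zE; have pE' := on_geodesic Ep' z0 zE.
have [] := zE (dist x0 p') (dist x0 p); first by rewrite /=; lia.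
rewrite -pE -pE' => E1 E2.
apply: (convex_between (@fix_convex k) gp'.1 (qk : fix_set k q)); lia.
Qed.

(* The oriented edges [(x, y)] and [(act g x, act g y)] point in the same
   direction, the first before the second, so that [g] translates an axis
   containing both. *)
Definition coherent g x y : Prop :=
  [/\ adj T x y, side x y (act g x) & ~ side (act g x) (act g y) x].

(** Otherwise the half-tree at [x] would meet both sides of the translated edge, hence contain that
    edge, against [side x y (act g x)]. *)
Lemma coherent_sub g x y u : coherent g x y ->
  side (act g x) (act g y) u -> side x y u.
Proof.
move=> [xy gx ngx] hu; apply: contrapT => hxu.
have yx : adj T y x by rewrite adj_sym.
have gxy : adj T (act g x) (act g y) by rewrite act_adj.
have [] := convex_cross (side_convex (treeT := treeT) yx) gxy _ _ hu ngx.
- exact/(sideN _ xy).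
- exact: side_end.
- by move=> /(sideN _ xy).
Qed.

Lemma coherent_iter g x y n : coherent g x y -> side x y (act (g ^+ n.+1) x).
Proof.
move=> cg; elim: n => [|n IHn]; first by case: cg.
rewrite expgS actM; apply: (coherent_sub cg).
exact/side_act.
Qed.

Lemma coherent_expg_neq g x y n : coherent g x y -> act (g ^+ n.+1) x <> x.
Proof. by move=> /(coherent_iter n) h E; rewrite E in h; exact: side_start h. Qed.

Lemma coherentV g x y : coherent g x y -> coherent g^-1 y x.
Proof.
move=> cg; have [xy gx ngx] := cg; have yx : adj T y x by rewrite adj_sym.
have gxy : adj T (act g x) (act g y) by rewrite act_adj.
split=> //.
  rewrite -(side_act _ g) actVK; apply/(sideN _ gxy) => hy.
  have [_ E] := side_cross gxy yx hy ngx.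
  by rewrite -E in gx; exact: side_start gx.
rewrite -(side_act _ g) !actVK => /(sideN _ xy); apply.
by apply: (coherent_sub cg); exact: side_end.
Qed.

(** Up to inverting [g], a fixed [p] lies beyond both edges; then [act g x] is on the geodesic from
    [p] to [x], at the same distance from [p] as [x], so it equals [x]. *)
Lemma coherent_no_fixed_point g x y p : coherent g x y -> act g p <> p.
Proof.
wlog px : g x y / side x y p => [wl cg|].
  have [xy _ _] := cg.
  have [px|/(sideN _ xy) px] := pselect (side x y p); first exact: wl px cg.
  by move=> gp; apply: (wl _ _ _ px (coherentV cg)); rewrite -[in LHS]gp actK.
move=> cg gp; have [xy gx ngx] := cg.
have gxy : adj T (act g x) (act g y) by rewrite act_adj.
have hp : side (act g x) (act g y) p by rewrite -gp side_act.
have := dist_sep gxy hp ngx.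
rewrite -[X in (_ = tree_dist _ X _ + _)%N]gp dist_act.
move=> E; have /(dist_eq0 (treeT := treeT)) E' : dist (act g x) x = 0%N by lia.
by rewrite E' in gx; exact: side_start gx.
Qed.

(* The edge starting at a vertex [v] with [dist v (act g v)] minimal is translated. *)
Lemma no_fixed_point_coherent g S : convex S -> S !=set0 ->
  (forall v, S v -> S (act g v)) -> (forall p, act g p <> p) ->
  exists v y, [/\ S v, S y & coherent g v y].
Proof.
move=> cS [v0 Sv0] gS ng.
have exn : exists n, `[< exists2 v, S v & dist v (act g v) = n >].
  by exists (dist v0 (act g v0)); apply/asboolP; exists v0.
case: (ex_minnP exn) => n /asboolP[v Sv En] min.
have minS u : S u -> (n <= dist u (act g u))%N.
  by move=> Su; apply: min; apply/asboolP; exists u.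
have [|y vy Ey] := @dist_next _ _ treeT v (act g v); first by move/esym; exact: ng.
have hy : side v y (act g v) by rewrite /half_tree /=; lia.
have Sy : S y by apply: (cS v (act g v)) => //; exact: gS.
exists v, y; split=> //; split=> //; rewrite /half_tree /= => lt.
have gvy : adj T (act g v) (act g y) by rewrite act_adj.
have vgy := sideE gvy lt; rewrite !(dist_sym treeT _ v) in vgy.
(* Either [g] inverts the edge, or the displacement of [y] is smaller by two than the minimal
   one. *)
have [E|vgyN] := pselect (v = act g y).
  have [_ _ _ noinv] := treeT; apply: (noinv g v y) => //; split=> //.
  by apply/esym/(dist_eq0 (treeT := treeT)); move: vgy; rewrite -E distxx; lia.
have [w vw Ew] := dist_next treeT vgyN.
have := dist_triangle treeT w (act g y) (act g v).
rewrite (dist_sym treeT (act g y)) (adj_dist treeT gvy) => tri.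
have E : y = w by apply: (@next_uniq_le _ _ treeT v _ _ (act g v)) => //; lia.
by have := minS y Sy; subst w; lia.
Qed.

(** Take for [v] the end in [S] of a shortest segment from [S] to [S']. The image of this segment
    under [h] has the same minimal length and passes through [v], so it also ends at [v]. *)
Lemma bridge_fixed_point S S' : convex S -> convex S' -> S !=set0 -> S' !=set0 ->
  S `&` S' = set0 ->
  exists v, forall h, (forall y, S (act h y) <-> S y) ->
    (forall y, S' (act h y) <-> S' y) -> act h v = v.
Proof.
move=> cS cS' S0 S'0 SS'.
have exn : exists n, `[< exists v p, [/\ S v, S' p & dist v p = n] >].
  have [v Sv] := S0; have [p Sp] := S'0.
  by exists (dist v p); apply/asboolP; exists v, p.
case: (ex_minnP exn) => n /asboolP[v [p [Sv Sp En]]] min.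
have minS u q : S u -> S' q -> (n <= dist u q)%N.
  by move=> Su Sq; apply: min; apply/asboolP; exists u, q.
have disj u : S u -> ~ S' u by move=> Su S'u; have : (S `&` S') u by []; rewrite SS'.
have [|v' vv' Ev] := @dist_next _ _ treeT v p; first by move=> E; apply: (disj v); rewrite // E.
have hp : side v v' p by rewrite /half_tree /=; lia.
have nSv' : ~ S v' by move=> Sv'; have := minS v' p Sv' Sp; lia.
exists v => h hS hS'.
have Shv : S (act h v) by exact/hS.
have S'hp : S' (act h p) by exact/hS'.
have hhv : ~ side v v' (act h v).
  by move=> hh; apply: nSv'; have [] := convex_cross cS vv' Shv Sv hh (@side_start _ _ treeT _ _).
have hhp : side v v' (act h p).
  by apply: contrapT => hh; apply: (disj v) => //; have [] := convex_cross cS' vv' Sp S'hp hp hh.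
have gp : gate S' v p by split=> // q Sq; rewrite En; exact: minS.
have E1 := dist_sep vv' hhp hhv; rewrite dist_act in E1.
have E2 := gateE cS' gp S'hp.
apply/esym/(dist_eq0 (treeT := treeT)).
by rewrite (dist_sym treeT p v) (dist_sym treeT _ v) in E1; lia.
Qed.

End TreeAction.

(** * Infinite cyclic subgroups and commensurability *)

Section CyclicSubgroups.
Context {G : groupType}.
Implicit Types (a b g h x y w : G) (H K : set G).
Local Open Scope classical_set_scope.
Local Open Scope group_scope.

Lemma subgroup1 H : subgroup H -> H 1.
Proof. by case=> /set_mem. Qed.

Lemma subgroupF H x y : subgroup H -> H x -> H y -> H (x / y).
Proof. by move=> sH Hx Hy; apply/set_mem/sH.2; exact/mem_set. Qed.

Lemma subgroupV H x : subgroup H -> H x -> H x^-1.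
Proof. by move=> sH Hx; rewrite -div1g; apply: subgroupF => //; exact: subgroup1. Qed.

Lemma subgroupM H x y : subgroup H -> H x -> H y -> H (x * y).
Proof. by move=> sH Hx Hy; rewrite -[y]invgK; apply: subgroupF => //; exact: subgroupV. Qed.

Lemma subgroupX H x n : subgroup H -> H x -> H (x ^+ n).
Proof.
move=> sH Hx; elim: n => [|n IHn]; first exact: subgroup1.
by rewrite expgS; exact: subgroupM.
Qed.

Lemma subgroupI H K : subgroup H -> subgroup K -> subgroup (H `&` K).
Proof.
move=> sH sK; split; first by apply/mem_set; split; exact: subgroup1.
move=> x y /set_mem[Hx Kx] /set_mem[Hy Ky]; apply/mem_set.
by split; exact: subgroupF.
Qed.

Lemma mem_cycle a : generated [set a] a.
Proof. exact: sub_gen_smallest. Qed.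

Lemma cycleP a b : generated [set a] b <-> exists n, b = a ^+ n \/ b = a ^- n.
Proof.
split; last first.
  have sa := subgroup_generated [set a].
  by move=> [n [->|->]]; [|apply: (subgroupV sa)]; apply: (subgroupX n sa); exact: mem_cycle.
suff sub : generated [set a] `<=` [set b | exists n, b = a ^+ n \/ b = a ^- n].
  exact: sub.
apply: generated_sub; last by move=> _ ->; exists 1%N; left.
split; first by apply/mem_set; exists 0%N; left.
have XF m n : exists k, a ^+ m / a ^+ n = a ^+ k \/ a ^+ m / a ^+ n = a ^- k.
  have [nm|mn] := leqP n m; first by exists (m - n)%N; left; rewrite expgnFr.
  by exists (n - m)%N; right; rewrite expgnFr ?invgF// ltnW.
move=> _ _ /set_mem[m [->|->]] /set_mem[n [->|->]]; apply/mem_set => //=.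
- by exists (m + n)%N; left; rewrite invgK expgnDr.
- by exists (n + m)%N; right; rewrite expgnDr invgM.
- rewrite invgK; have [k E] := XF n m; exists k; move: E.
  suff -> : a ^- m * a ^+ n = a ^+ n / a ^+ m by [].
  by apply/commute_sym/commuteV/commuteX2.
Qed.

Lemma cycle_commute a x y :
  generated [set a] x -> generated [set a] y -> commute x y.
Proof.
move=> /cycleP[m mx] /cycleP[n ny].
have c : commute (a ^+ m) (a ^+ n) by apply: commuteX2.
case: mx ny => -> [] -> //; first exact: commuteV.
- by apply/commute_sym/commuteV/commute_sym.
- by apply/commute_sym/commuteV/commute_sym/commuteV.
Qed.

Lemma infinite_cyclic_subgroup H : infinite_cyclic H -> subgroup H.
Proof. by move=> [_ [a ->]]; exact: subgroup_generated. Qed.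

Lemma infinite_cyclic_expg_neq1 a n :
  infinite_cyclic (generated [set a]) -> a ^+ n.+1 <> 1.
Proof.
move=> [inf _] an; apply: inf.
have -> : generated [set a] = (fun i => a ^+ i) @` `I_n.+1; last first.
  exact/finite_image/finite_II.
have red m : exists2 i, (i < n.+1)%N & a ^+ m = a ^+ i.
  exists (m %% n.+1)%N; first exact: ltn_pmod.
  by rewrite {1}(divn_eq m n.+1) expgnDr mulnC expgnA an expg1n mul1g.
apply/seteqP; split=> [x /cycleP[m [->|->]]|_ [i _ <-]].
- by have [i ? ?] := red m; exists i.
- have [i ? E] := red (n * m)%N; exists i => //; rewrite -E; apply: (mulIg (a ^+ m)).
  by rewrite mulVg -expgnDr -mulSnr expgnA an expg1n.
- by apply/cycleP; exists i; left.
Qed.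

Lemma infinite_cyclic_neq1 H : infinite_cyclic H -> exists2 w, w <> 1 & H w.
Proof.
move=> iH; have [_ [a Ha]] := iH; exists a; last by rewrite Ha; exact: mem_cycle.
by rewrite Ha in iH; exact: (@infinite_cyclic_expg_neq1 a 0 iH).
Qed.

(** Some power [a ^+ m] of a generator with [m] positive lies in [K], so the powers with exponent
    below [m] represent all cosets. *)
Lemma finite_index_cyclic H K w : infinite_cyclic H -> subgroup K ->
  w <> 1 -> H w -> K w -> finite_index (H `&` K) H.
Proof.
move=> iH sK w1 Hw Kw; have [_ [a Ha]] := iH.
have sI := subgroupI (infinite_cyclic_subgroup iH) sK.
have [m m0 [Hm Km]] : exists2 m, (0 < m)%N & (H `&` K) (a ^+ m).
  move: Hw Kw; rewrite {1}Ha => /cycleP[m wm] Kw.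
  exists m; first by case: m wm => // -[] E; case: w1; rewrite E ?invg1.
  split; first by rewrite Ha; apply/cycleP; exists m; left.
  by case: wm Kw => -> // /(subgroupV sK); rewrite invgK.
have red n : exists i k, [/\ (i < m)%N, (H `&` K) k & a ^+ n = a ^+ i * k].
  exists (n %% m)%N, (a ^+ (m * (n %/ m))); split; first exact: ltn_pmod.
    by rewrite expgnA; exact: subgroupX.
  by rewrite -expgnDr {1}(divn_eq n m) addnC mulnC.
apply: (@sub_finite_set _ _
  ((fun i => [set a ^+ i * h | h in H `&` K]) @` `I_m)); last first.
  exact/finite_image/finite_II.
move=> _ [x Hx <-].
suff [i [k [im Ik ->]]] : exists i k, [/\ (i < m)%N, (H `&` K) k & x = a ^+ i * k].
  exists i => //; apply/seteqP; split=> [_ [h Ih <-]|_ [h Ih <-]]; last first.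
    by exists (k * h); [exact: subgroupM|rewrite mulgA].
  by exists (k^-1 * h); [apply: subgroupM => //; exact: subgroupV|rewrite mulgA mulgK].
have /cycleP[n [->|->]] : generated [set a] x by rewrite -Ha.
  exact: red.
(* Negative exponents reduce to the previous case: [a ^- n] is [a ^+ (n * m.-1)] times
   [a ^- (m * n)], and the latter lies in the intersection. *)
have [i [k [im Ik E]]] := red (n * m.-1)%N.
exists i, (k * a ^- (m * n)); split => //.
  by apply: subgroupM => //; apply: subgroupV => //; rewrite expgnA; exact: subgroupX.
rewrite mulgA -E; apply: (mulIg (a ^+ (m * n))).
rewrite mulgVK; have -> : (m * n = n + n * m.-1)%N by nia.
by rewrite expgnDr mulgA mulVg mul1g.
Qed.

(** With trivial intersection the cosets in [H] would be singletons, and finite index would make [H]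
    finite. *)
Lemma commensurable_infinite_cyclic H K : infinite_cyclic H -> infinite_cyclic K ->
  commensurable H K <-> exists w, [/\ w <> 1, H w & K w].
Proof.
move=> iH iK; have sH := infinite_cyclic_subgroup iH.
have sK := infinite_cyclic_subgroup iK; split; last first.
  move=> [w [w1 Hw Kw]]; split; first exact: finite_index_cyclic w1 Hw Kw.
  by rewrite setIC; exact: finite_index_cyclic w1 Kw Hw.
move=> [fin _]; apply: contrapT => nw; case: iH => inf _; apply: inf.
apply: (sub_finite_set _ (finite_image (xget 1) fin)).
move=> x Hx; exists [set x * h | h in H `&` K]; first by exists x.
have -> : [set x * h | h in H `&` K] = [set x]; last by apply: xget_unique.
apply/seteqP; split=> [_ [h [Hh Kh] <-]|_ ->]; last first.
  by exists 1; [split; exact: subgroup1|rewrite mulg1].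
have -> : h = 1 by apply: contrapT => h1; apply: nw; exists h.
by rewrite mulg1.
Qed.

Lemma commensurable_refl H : infinite_cyclic H -> commensurable H H.
Proof.
by move=> iH; have [w w1 Hw] := infinite_cyclic_neq1 iH;
  apply/commensurable_infinite_cyclic => //; exists w.
Qed.

Lemma commensurable_sym H K : commensurable H K -> commensurable K H.
Proof. by rewrite /commensurable setIC => -[]. Qed.

Lemma commensurable_trans H K L :
  infinite_cyclic H -> infinite_cyclic K -> infinite_cyclic L ->
  commensurable H K -> commensurable K L -> commensurable H L.
Proof.
move=> iH iK iL.
move=> /(commensurable_infinite_cyclic iH iK)[v [v1 Hv Kv]].
move=> /(commensurable_infinite_cyclic iK iL)[w [w1 Kw Lw]].
apply/commensurable_infinite_cyclic => //.
have sH := infinite_cyclic_subgroup iH; have sL := infinite_cyclic_subgroup iL.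
have [_ [a Ka]] := iK.
move: Kv Kw; rewrite Ka => /cycleP[m vm] /cycleP[n wn].
(* Up to inversion a power of both [v] and [w], non-trivial because [m] and [n] are positive. *)
exists (a ^+ (m * n)); split.
- have : (0 < m * n)%N.
    rewrite muln_gt0; case: m vm => [|m] vm.
      by case: v1; case: vm => ->; rewrite ?invg1.
    case: n wn => [|n] wn //; by case: w1; case: wn => ->; rewrite ?invg1.
  by case: (m * n)%N => // k _; apply: infinite_cyclic_expg_neq1; rewrite -Ka.
- rewrite expgnA; apply: subgroupX => //.
  by case: vm Hv => -> // /(subgroupV sH); rewrite invgK.
- rewrite mulnC expgnA; apply: subgroupX => //.
  by case: wn Lw => -> // /(subgroupV sL); rewrite invgK.
Qed.

End CyclicSubgroups.

(** * Solvable Baumslag-Solitar groups and their embeddings *)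

Section BaumslagSolitarSubgroups.
Context {G : groupType}.
Variables (a t : G).
Local Open Scope classical_set_scope.
Local Open Scope group_scope.
Local Notation cyc x := (generated [set x]).

Definition eval_letter (l : bool * bool) : G :=
  let x := if l.1 then t else a in if l.2 then x^-1 else x.

Definition eval_word (w : seq (bool * bool)) : G :=
  foldr (fun l acc => eval_letter l * acc) 1 w.

Lemma eval_word_cat v w : eval_word (v ++ w) = eval_word v * eval_word w.
Proof. by elim: v => [|l v IHv] /=; rewrite ?mul1g// IHv mulgA. Qed.

Lemma eval_word_nseq n b :
  eval_word (nseq n (false, b)) = if b then a ^- n else a ^+ n.
Proof.
elim: n => [|n IHn] /=; first by rewrite invg1; case: b.
by rewrite IHn; case: b {IHn}; rewrite /eval_letter /= ?expgS// -invgM -expgSr expgS.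
Qed.

Lemma eval_word_eq s v w : eval_word (nseq `|s|%N (false, (s < 0)%R)) = t * a * t^-1 ->
  word_eq (BS_relation s) v w -> eval_word v = eval_word w.
Proof.
move=> rel; elim=> {v w} //.
- by move=> u v w _ -> _ ->.
- by move=> u u' v v' _ E _ E'; rewrite !eval_word_cat E E'.
- by move=> x [] /=; rewrite /eval_letter /= mulg1 ?mulVg ?mulgV.
- by move=> u v [-> ->]; rewrite rel /= /eval_letter /= mulg1 mulgA.
Qed.

Lemma conj_cycle (B : groupType) (A U x : B) :
  cyc A (U * A * U^-1) -> cyc A x -> cyc A (U * x * U^-1).
Proof.
move=> cU cx; have : conjs U (cyc A) (U * x * U^-1) by exists x.
rewrite conjs_generated; apply: generated_sub; first exact: subgroup_generated.
by move=> _ [_ -> <-].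
Qed.

Lemma conjX_cycle (B : groupType) (A U x : B) n :
  cyc A (U * A * U^-1) -> cyc A x -> cyc A (U ^+ n * x * U ^- n).
Proof.
move=> cU cx; elim: n => [|n IHn]; first by rewrite mul1g invg1 mulg1.
have -> : U ^+ n.+1 * x * U ^- n.+1 = U * (U ^+ n * x * U ^- n) * U^-1.
  by rewrite expgS invgM !mulgA.
exact: conj_cycle.
Qed.

(** Induction on [w], multiplying on the left by a letter: a power of [A] moves past [U ^- i] by
    conjugation with [U ^+ i], which stays in the cyclic group of [A]; [U^-1] increases [i]; [U]
    decreases it, or conjugates [b] when [i] is zero. *)
Lemma BS_normal_form s (w : seq (bool * bool)) (B := BS s)
    (A := pg_of (BS_relation s) [:: (false, false)] : B)
    (U := pg_of (BS_relation s) [:: (true, false)] : B) :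
  exists i l b, cyc A b /\ (pg_of (BS_relation s) w : B) = U ^- i * b * U ^+ l.
Proof.
have catE v v' : (pg_of (BS_relation s) (v ++ v') : B) =
    (pg_of (BS_relation s) v : B) * pg_of (BS_relation s) v'.
  exact: pg_of_cat.
have invE x : (pg_of (BS_relation s) [:: (x, true)] : B) =
    (pg_of (BS_relation s) [:: (x, false)] : B)^-1.
  apply: (mulIg (pg_of (BS_relation s) [:: (x, false)] : B)).
  by rewrite mulVg -catE; apply/pg_ofP; exact: word_eq_cancel _ x true.
have nseqE n b : (pg_of (BS_relation s) (nseq n (false, b)) : B) =
    if b then A ^- n else A ^+ n.
  elim: n => [|n IHn]; first by rewrite invg1; case: b.
  rewrite -[nseq _ _]/([:: (false, b)] ++ nseq n (false, b)) catE IHn.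
  case: b {IHn}; last by rewrite expgS.
  by rewrite invE -invgM -expgSr.
have rel : cyc A (U * A * U^-1).
  have -> : U * A * U^-1 = pg_of (BS_relation s) (nseq `|s|%N (false, (s < 0)%R)).
    rewrite -invE -(catE [:: _] [:: _]) -catE; apply/pg_ofP; apply: word_eq_rel; exact: erefl.
  by rewrite nseqE; apply/cycleP; exists `|s|%N; case: ifP; [right|left].
have sA := subgroup_generated [set A]; have AA := @mem_cycle B A.
elim: w => [|[x c] w [i [l [b [cb E]]]]].
  by exists 0%N, 0%N, 1; split; [exact: subgroup1|rewrite invg1 !mul1g].
rewrite -cat1s catE E.
case: x; last first.
  have [y cy ->] : exists2 y, cyc A y & pg_of (BS_relation s) [:: (false, c)] = y.
    by case: c; [rewrite invE; exists A^-1; [exact: (subgroupV sA)|]|exists A].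
  exists i, l, ((U ^+ i * y * U ^- i) * b); split.
    by apply: (subgroupM sA) => //; exact: conjX_cycle.
  by rewrite !mulgA mulVg mul1g.
case: c; first rewrite invE.
  by exists i.+1, l, b; split=> //; rewrite expgSr invgM !mulgA.
case: i {E} => [|i]; last first.
  by exists i, l, b; split=> //; rewrite expgSr invgM !mulgA mulgV mul1g.
exists 0%N, l.+1, (U * b * U^-1); split; first exact: conj_cycle.
by rewrite invg1 !mul1g expgS !mulgA mulgVK.
Qed.

(** A kernel element in normal form [U ^- i * b * U ^+ l] puts [t ^+ i / t ^+ l] in the cyclic group
    of [a]. This forces [i = l], and then [b = 1] since [a] has infinite order. *)
Lemma solvable_BS_embedding : (forall n, a ^+ n.+1 <> 1) ->
  cyc a (t * a * t^-1) -> (forall n, ~ cyc a (t ^+ n.+1)) ->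
  exists2 K : set G, solvable_BS_subgroup K & K t.
Proof.
move=> a_inf cta tn.
have [s s0 rel] : exists2 s : int, s <> 0%R &
    eval_word (nseq `|s|%N (false, (s < 0)%R)) = t * a * t^-1.
  have nt : t * a * t^-1 <> 1.
    move=> E; apply: (a_inf 0%N); apply: (mulgI t); rewrite mulg1.
    by apply: (mulIg t^-1); rewrite E mulgV.
  move: cta nt => /cycleP[n tan] nt; case: n tan => [|n] tan.
    by case: nt; case: tan => ->; rewrite ?invg1.
  by case: tan => ->; [exists (Posz n.+1)|exists (Negz n)] => //; rewrite eval_word_nseq.
pose R := BS_relation s; pose B := BS s.
pose f (x : B) : G := eval_word (repr (x : presented_group R)).
have fE w : f (pg_of R w) = eval_word w by apply: (eval_word_eq rel); exact: repr_pg_of.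
have fM : {morph f : x y / x * y}.
  by move=> x y; rewrite -eval_word_cat -fE.
have fF : {morph f : x y / x / y}.
  by move=> x y; apply: (mulIg (f y)); rewrite -fM !mulgVK.
pose F : UMagmaMorphism.type B G := HB.pack f (isGroupMorphism.Build B G f fF).
pose A : B := pg_of R [:: (false, false)]; pose U : B := pg_of R [:: (true, false)].
have FA : F A = a by rewrite /= fE /= mulg1.
have FU : F U = t by rewrite /= fE /= mulg1.
exists (range f); last by exists U.
exists s => //; exists f; split=> //.
change (injective F); apply: gmulf_inj => x; rewrite -[x](@pg_of_repr _ R).
have [i [l [b [/cycleP[n bE] ->]]]] := BS_normal_form s (repr (x : presented_group R)).
rewrite -/A -/U in bE *.
rewrite !gmulfM gmulfXVn gmulfXn FU => E.
have E' : F b = t ^+ i / t ^+ l.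
  by apply: (mulIg (t ^+ l)); rewrite mulgVK; apply: (mulgI (t ^- i)); rewrite mulgA E mulVg.
have cFb : cyc a (F b).
  apply/cycleP; exists n; case: bE => ->; [left|right];
  by rewrite ?gmulfXVn ?gmulfXn FA.
have [il|li|il] := ltngtP i l.
- case: (tn (l - i).-1); rewrite prednK ?subn_gt0// expgnFr ?(ltnW il)//.
  by rewrite -invgF -E'; apply: (subgroupV (subgroup_generated _)).
- by case: (tn (i - l).-1); rewrite prednK ?subn_gt0// expgnFr ?(ltnW li)// -E'.
- rewrite il mulgV in E'; rewrite il.
  suff -> : b = 1 by rewrite mulg1 mulVg.
  case: n bE => [|n] bE; first by case: bE => ->; rewrite ?invg1.
  case: bE E' => ->; rewrite ?gmulfXVn ?gmulfXn FA; first by move=> /a_inf.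
  by move=> /eqP; rewrite invg_eq1 => /eqP/a_inf.
Qed.

End BaumslagSolitarSubgroups.

(** * Reachability along a relation, and the pigeonhole principle *)

Section Joined.
Context {X : eqType}.
Implicit Types (R : rel X) (x y z : X).
Local Open Scope classical_set_scope.

(** Agrees by unfolding with the connectedness clause of [is_tree] and with membership in
    [component], so one induction principle serves both. *)
Definition joined R x y : Prop := exists2 p, path R x p & last x p = y.

Lemma joined_refl R x : joined R x x.
Proof. by exists [::]. Qed.

Lemma joined_step R x y : R x y -> joined R x y.
Proof. by move=> xy; exists [:: y]; rewrite /= ?xy. Qed.

Lemma joined_trans R y x z : joined R x y -> joined R y z -> joined R x z.
Proof.
move=> [p xp lp] [q yq lq]; exists (p ++ q); first by rewrite cat_path xp lp.
by rewrite last_cat lp.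
Qed.

Lemma joined_ind R x (P : X -> Prop) : P x ->
  (forall y z, joined R x y -> P y -> R y z -> P z) ->
  forall y, joined R x y -> P y.
Proof.
move=> Px IH y [p xp <-]; elim/last_ind: p xp => [//|p z IHp].
rewrite rcons_path last_rcons => /andP[xp pz].
by apply: IH (IHp xp) pz; exists p.
Qed.

Lemma joined_sym R x y : symmetric R -> joined R x y -> joined R y x.
Proof.
move=> symR; move: y; apply: (joined_ind (P := fun y => joined R y x)); first exact: joined_refl.
by move=> u z _ IH uz; apply: joined_trans IH; apply: joined_step; rewrite symR.
Qed.

Lemma joined_cross R x y (P : set X) : joined R x y -> P x -> ~ P y ->
  exists u v, [/\ R u v, P u & ~ P v].
Proof.
move=> xy Px nPy; apply: contrapT => nuv; apply: nPy; move: y xy.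
apply: (joined_ind (P := P)) => // u v _ Pu uv; apply: contrapT => nPv.
by apply: nuv; exists u, v.
Qed.

End Joined.

Lemma joined_map (X X' : eqType) (f : X -> X') (R : rel X) (R' : rel X') x y :
  (forall u v, R u v -> R' (f u) (f v)) -> joined R x y -> joined R' (f x) (f y).
Proof.
move=> fR; move: y; apply: (joined_ind (P := fun y => joined R' (f x) (f y))).
  exact: joined_refl.
by move=> u v _ IH uv; apply: joined_trans IH _; exact/joined_step/fR.
Qed.

Lemma pigeonhole (n : nat) (f : nat -> nat) :
  (forall i, (i < n.+1)%N -> (f i < n)%N) ->
  exists i j, [/\ (i < j)%N, (j < n.+1)%N & f i = f j].
Proof.
move=> fn; apply: contrapT => nij.
pose F (i : 'I_n.+1) : 'I_n := Ordinal (fn i (ltn_ord i)).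
have injF : injective F.
  move=> i j /(congr1 val) /= fij; apply: val_inj.
  have [lt|lt|//] := ltngtP (val i) (val j); case: nij.
    by exists i, j.
  by exists j, i.
by have := leq_card F injF; rewrite !card_ord ltnn.
Qed.

(** * An invariant subtree with finitely many orbits of edges *)

Section CofiniteSubtree.
Context {G : groupType} {T : ggraph G}.
Hypothesis treeT : is_tree T.
Implicit Types (x y z u v p q : T) (g h k : G) (S : set T) (L : seq (T * T)).
Local Open Scope classical_set_scope.
Local Open Scope group_scope.
Local Notation side := (half_tree treeT).
Local Notation convex := (convex treeT).

Definition translate L : rel T := fun u v =>
  `[< exists g a, [/\ a \in L, u = act g a.1 & v = act g a.2] >].

Definition symmetric_edges L :=
  forall a, a \in L -> adj T a.1 a.2 /\ (a.2, a.1) \in L.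

Lemma translate_cat L L' u v : translate L u v || translate L' u v ->
  translate (L ++ L') u v.
Proof.
by move=> /orP[] /asboolP[g [a [aL ua va]]]; apply/asboolP; exists g, a;
  rewrite mem_cat aL ?orbT.
Qed.

Lemma joined_translate_cat L L' u v :
  joined (translate L) u v \/ joined (translate L') u v ->
  joined (translate (L ++ L')) u v.
Proof.
by case; apply: (@joined_map _ _ id) => a b ab; apply: translate_cat; rewrite ab ?orbT.
Qed.

Lemma symmetric_edges_cat L L' : symmetric_edges L -> symmetric_edges L' ->
  symmetric_edges (L ++ L').
Proof.
move=> sL sL' a; rewrite !mem_cat => /orP[/sL|/sL'] [-> ->] //.
by rewrite orbT.
Qed.

Lemma joined_translate x y :
  exists2 L, symmetric_edges L & joined (translate L) x y.
Proof.
have [_ conn _ _] := treeT.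
have : joined (adj T) x y by exact: conn.
move: y; apply: (joined_ind (P := fun y =>
  exists2 L, symmetric_edges L & joined (translate L) x y)).
  by exists [::] => //; exact: joined_refl.
move=> y z _ [L sL xy] yz; exists (L ++ [:: (y, z); (z, y)]).
  apply: symmetric_edges_cat => // a; rewrite !inE => /orP[]/eqP -> /=.
    by rewrite yz eqxx orbT.
  by rewrite adj_sym yz eqxx.
apply: (joined_trans (y := y)); apply: joined_translate_cat; [by left|right].
by apply: joined_step; apply/asboolP; exists 1, (y, z); rewrite inE eqxx !act1.
Qed.

Lemma joined_translate_seq x (s : seq G) : exists2 L, symmetric_edges L &
  forall g, g \in s -> joined (translate L) x (act g x).
Proof.
elim: s => [|h s [L sL Ls]]; first by exists [::].
have [L' sL' Lh] := joined_translate x (act h x); exists (L' ++ L).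
  exact: symmetric_edges_cat.
move=> g; rewrite inE => /orP[/eqP->|/Ls gL]; apply: joined_translate_cat; by [left|right].
Qed.

Lemma translate_sym L : symmetric_edges L -> symmetric (translate L).
Proof.
move=> sL; suff imp u v : translate L u v -> translate L v u.
  by move=> u v; apply/idP/idP; exact: imp.
move=> /asboolP[g [a [/sL[_ aL] -> ->]]]; apply/asboolP.
by exists g, (a.2, a.1).
Qed.

Lemma joined_translate_act L g u v :
  joined (translate L) u v -> joined (translate L) (act g u) (act g v).
Proof.
apply: joined_map => {u v} _ _ /asboolP[h [a [aL -> ->]]]; apply/asboolP.
by exists (g * h), a; rewrite !actM.
Qed.

(** The finite list [L] joins [x0] to its images under the generators, so what is reached from [x0]
    along translates of [L] is invariant and connected. *)
Lemma cofinite_subtree : finitely_generated G ->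
  exists (S : set T) (L : seq (T * T)), [/\ S !=set0,
    forall g y, S (act g y) <-> S y, convex S &
    forall u v y, S u -> S v -> adj T u y -> side u y v ->
      exists g a, [/\ a \in L, u = act g a.1 & y = act g a.2]].
Proof.
move=> [s gen]; have [[x0] _ _ _] := treeT.
have [L sL Ls] := joined_translate_seq x0 s.
pose S : set T := [set u | joined (translate L) x0 u].
have symL := translate_sym sL.
have orb g : S (act g x0).
  have : generated [set` s] g by rewrite gen.
  move: g; apply: generated_sub => [|g gs]; last exact: Ls.
  split; first by apply/mem_set; rewrite /= act1; exact: joined_refl.
  move=> g h /set_mem Sg /set_mem Sh; apply/mem_set.
  have Shi : joined (translate L) x0 (act h^-1 x0).
    apply: (joined_sym symL); rewrite -[X in joined _ _ X](actK h).
    exact: joined_translate_act.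
  by apply: (joined_trans Sg); rewrite actM; exact: joined_translate_act.
have SgP g y : S y -> S (act g y).
  by move=> Sy; apply: (joined_trans (orb g)); exact: joined_translate_act.
(* A path of translates from [v] to [u] must leave the half-tree at [y], which is possible only
   along the edge [u -- y] itself. *)
have edges u v y : S u -> S v -> adj T u y -> side u y v ->
    exists g a, [/\ a \in L, u = act g a.1 & y = act g a.2].
  move=> Su Sv uy hv.
  have uv : joined (translate L) v u.
    by apply: (joined_trans _ Su); exact: joined_sym.
  have [b [c [bc hb hc]]] := joined_cross uv hv (@side_start _ _ treeT u y).
  have adj_bc : adj T b c.
    by move/asboolP: bc => [g [a [/sL[ab _] -> ->]]]; rewrite act_adj.
  have [-> ->] : u = c /\ y = b by have [-> ->] := side_cross uy adj_bc hb hc.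
  by apply/asboolP; rewrite -/(translate L c b) symL.
exists S, L; split=> //.
- by exists x0; exact: joined_refl.
- by move=> g y; split=> [/(SgP g^-1)|]; [rewrite actK|exact: SgP].
- move=> u v y Su Sv uy hv; apply: (joined_trans Su); apply: joined_step.
  exact/asboolP/(edges _ v).
Qed.

End CofiniteSubtree.

(** * Cylinders and fixed vertices of their stabilizers *)

Section CylinderStabilizers.
Context {G : groupType} {T : ggraph G}.
Hypothesis treeT : is_tree T.
Hypothesis cyclic_edges : forall e : set T, edge T e -> infinite_cyclic (fixer e).
Implicit Types (x y z u v p q : T) (g h k : G) (e : set T) (Y : set (set T)).
Local Open Scope classical_set_scope.
Local Open Scope group_scope.
Local Notation dist := (tree_dist treeT).
Local Notation side := (half_tree treeT).
Local Notation convex := (convex treeT).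

Lemma fixer_pair x y g : fixer [set x; y] g <-> act g x = x /\ act g y = y.
Proof.
split=> [fg|[gx gy] z [->|->]//].
by split; apply: fg; [left|right].
Qed.

Lemma image_act_pair g x y : act g @` [set x; y] = [set act g x; act g y].
Proof. by rewrite image_setU !image_set1. Qed.

Lemma edge_pair x y : adj T x y -> edge T [set x; y].
Proof. by move=> xy; exists x, y. Qed.

Lemma cylinder_edge Y e : cylinder Y -> Y e -> edge T e.
Proof. by move=> [e0 _ ->] []. Qed.

Lemma mem_edge_class e : edge T e -> edge_class e e.
Proof. by move=> ee; split=> //; exact/commensurable_refl/cyclic_edges. Qed.

Lemma cylinder_edge_class e : edge T e -> cylinder (edge_class e).
Proof. by exists e. Qed.

Lemma cylinderE Y e : cylinder Y -> Y e -> Y = edge_class e.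
Proof.
move=> [e0 ee0 ->] [ee ce]; have [c0 c] := (cyclic_edges ee0, cyclic_edges ee).
apply/seteqP; split=> e' [ee' ce']; split=> //; have c' := cyclic_edges ee'.
  exact: commensurable_trans (commensurable_sym ce) ce'.
exact: commensurable_trans ce ce'.
Qed.

Lemma cylinder_uniq Y Y' e : cylinder Y -> cylinder Y' -> Y e -> Y' e -> Y = Y'.
Proof. by move=> cY cY' /(cylinderE cY) -> /(cylinderE cY') ->. Qed.

Lemma mem_cylinderP Y e e' : cylinder Y -> Y e -> edge T e' ->
  Y e' <-> exists w, [/\ w <> 1, fixer e w & fixer e' w].
Proof.
move=> cY Ye ee'; have ee := cylinder_edge cY Ye.
rewrite (cylinderE cY Ye) -commensurable_infinite_cyclic; try exact: cyclic_edges.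
by split=> [[]|].
Qed.

(** Edges of [Y] at [u] and at [v] have stabilizers sharing a non-trivial element; it fixes [u] and
    [v], hence the first edge between them. *)
Lemma cylinder_next Y u v y : cylinder Y -> on_cylinder u Y -> on_cylinder v Y ->
  adj T u y -> side u y v -> Y [set u; y].
Proof.
move=> cY [e Ye eu] [e' Ye' e'v] uy hv.
have [w [w1 we we']] := (mem_cylinderP cY Ye (cylinder_edge cY Ye')).1 Ye'.
apply/(mem_cylinderP cY Ye (edge_pair uy)); exists w; split=> //.
apply/fixer_pair; split; first exact: we.
by apply: (@fix_convex _ _ treeT w u v y) => //; [exact: we|exact: we'].
Qed.

Lemma cylinder_convex Y : cylinder Y -> convex [set u | on_cylinder u Y].
Proof.
move=> cY u v y Yu Yv uy hv; exists [set u; y]; last by right.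
exact: cylinder_next Yu Yv uy hv.
Qed.

Lemma cylinder_nonempty Y : cylinder Y -> [set u | on_cylinder u Y] !=set0.
Proof.
move=> [e ee ->]; have [x [y [xy E]]] := ee.
by exists x, e; [exact: mem_edge_class|rewrite E; left].
Qed.

Definition cylinder_stabilizer Y : set G := [set g | act_sets g Y = Y].

(** Translates of cylinders are cylinders, and two cylinders sharing an edge coincide, so one edge
    decides. *)
Lemma cylinder_stabilizerP Y e g : cylinder Y -> Y e ->
  cylinder_stabilizer Y g <-> Y (act g @` e).
Proof.
move=> cY Ye; split=> [<-|Yge]; first by exists e.
by rewrite /cylinder_stabilizer /= {1}(cylinderE cY Ye) edge_class_act -(cylinderE cY Yge).
Qed.

Lemma on_cylinder_stabilizer Y g u : cylinder_stabilizer Y g ->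
  on_cylinder (act g u) Y <-> on_cylinder u Y.
Proof. by move=> gY; rewrite -[in X in X <-> _]gY; exact: on_cylinder_actE. Qed.

Lemma cylinder_stabilizer_subgroup Y : subgroup (cylinder_stabilizer Y).
Proof.
split; first by apply/mem_set/act_sets1.
move=> g h /set_mem gY /set_mem hY; apply/mem_set.
rewrite /cylinder_stabilizer /= act_setsM -[X in act_sets _ (act_sets _ X)]hY.
by rewrite -(act_setsM h^-1) mulVg act_sets1.
Qed.

Lemma infinite_cyclic_commute (H : set G) g h :
  infinite_cyclic H -> H g -> H h -> commute g h.
Proof. by move=> [_ [a ->]]; exact: cycle_commute. Qed.

Hypothesis CT : commutative_transitive G.
Hypothesis BS_elliptic : forall K : set G, solvable_BS_subgroup K -> elliptic T K.

(* With [c] a generator of the stabilizer of the edge [e = (x, y)], the elements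
   [c] and [g^2 c g^-2] commute, so they fix a common vertex [p]. The edge [g e]
   lies between [e] and [g^2 e], so [p] is separated by [g e] from one of them,
   and the corresponding element fixes [g e]. *)
Lemma cylinder_no_coherent Y g x y : cylinder Y -> cylinder_stabilizer Y g ->
  Y [set x; y] -> ~ coherent treeT g x y.
Proof.
move=> cY gY Ye cg; have [xy gx ngx] := cg.
have sY := cylinder_stabilizer_subgroup Y.
have icF := cyclic_edges (edge_pair xy); have [_ [c Fc]] := icF.
have gxy : adj T (act g x) (act g y) by rewrite act_adj.
have cF : fixer [set x; y] c by rewrite Fc; exact: mem_cycle.
have [cx cy] := (fixer_pair _ _ _).1 cF.
pose c2 := g * (g * c * g^-1) * g^-1.
have c_inf n : c ^+ n.+1 <> 1 by apply: infinite_cyclic_expg_neq1; rewrite -Fc.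
have no_BS t : generated [set c] (t * c * t^-1) ->
    (forall n, ~ fixer [set x; y] (t ^+ n.+1)) -> (forall p, act t p <> p) -> False.
  move=> ct tn nt; rewrite Fc in tn.
  have [K /BS_elliptic[p fp] Kt] := solvable_BS_embedding c_inf ct tn.
  by apply: (nt p); apply: fp => //.
have gn n : ~ fixer [set x; y] (g ^+ n.+1).
  by move=> /fixer_pair[E _]; exact: (coherent_expg_neq cg E).
have F2 : fixer (act (g * g) @` [set x; y]) c2.
  by rewrite image_actM !fixer_act; exists (g * c * g^-1) => //; exists c.
have Yg2 : Y (act (g * g) @` [set x; y]).
  by apply/(cylinder_stabilizerP _ cY Ye); exact: subgroupM.
have eg2 := cylinder_edge cY Yg2.
(* The stabilizers of two edges of [Y] share a non-trivial [w]; both [c] and [c2] commute with it,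
   so commutative transitivity applies. *)
have [w [w1 wF wF2]] := (mem_cylinderP cY Ye eg2).1 Yg2.
have cc2 : commute c c2.
  apply: (CT w1); apply/mem_set; first exact: infinite_cyclic_commute icF cF wF.
  exact: infinite_cyclic_commute (cyclic_edges eg2) F2 wF2.
have c2x : act c2 (act g (act g x)) = act g (act g x).
  by rewrite -(actM g g); apply: F2; exists x => //; left.
have [|p [cp c2p]] := commute_common_fixed_point treeT cc2 (ex_intro _ x cx) _.
  by exists (act g (act g x)).
have [hp|hp] := pselect (side (act g x) (act g y) p).
  have [cgx cgy] := convex_cross (@fix_convex _ _ treeT c) gxy cp cx hp ngx.
  apply: (no_BS g^-1).
  - rewrite -Fc invgK; apply/fixer_pair.
    by rewrite !actM cgx cgy !actK.
  - move=> n; rewrite expVgn => /(subgroupV (infinite_cyclic_subgroup icF)).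
    by rewrite invgK; exact: gn.
  - by move=> q gq; apply: (coherent_no_fixed_point (p := q) cg); rewrite -[in LHS]gq actVK.
have hgx : side (act g x) (act g y) (act g (act g x)) by rewrite side_act.
(* Here [c2] fixes the translated edge; undoing one conjugation by [g], the element [g * c * g^-1]
   fixes the original one. *)
have [c2gx c2gy] := convex_cross (@fix_convex _ _ treeT c2) gxy c2x c2p hgx hp.
apply: (no_BS g) => //; last by move=> q; exact: coherent_no_fixed_point cg.
have c2E u : act c2 (act g u) = act g (act (g * c * g^-1) u).
  by rewrite -!actM /c2 mulgVK.
by rewrite -Fc; apply/fixer_pair; split; apply: (can_inj (actK g)); rewrite -c2E.
Qed.

(** Without fixed vertex, [g] would translate an edge of the invariant subtree [Y]. *)
Lemma cylinder_stabilizer_elliptic Y g : cylinder Y -> cylinder_stabilizer Y g ->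
  exists p, act g p = p.
Proof.
move=> cY gY; apply: contrapT => nfix.
have [v Yv|p gp|v [y [Yv Yy cg]]] := no_fixed_point_coherent (treeT := treeT) (g := g)
  (cylinder_convex cY) (cylinder_nonempty cY).
- exact/(on_cylinder_stabilizer _ gY).
- by apply: nfix; exists p.
have [vy hgv _] := cg; apply: (cylinder_no_coherent cY gY _ cg).
by apply: cylinder_next hgv => //; exact/(on_cylinder_stabilizer _ gY).
Qed.

Hypothesis fgG : finitely_generated G.

(* If [G_Y] fixed no vertex, fixed subtrees of its elements would be arbitrarily
   far from a vertex [x0] of [Y] in a subtree with finitely many orbits of edges;
   then two edges of [Y] on a long segment are coherent translates. *)
Lemma cylinder_fixed_point Y : cylinder Y ->
  exists2 p, on_cylinder p Y & forall g, cylinder_stabilizer Y g -> act g p = p.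
Proof.
move=> cY; set H := cylinder_stabilizer Y; pose C : set T := [set u | on_cylinder u Y].
have cC : convex C := cylinder_convex cY; have C0 : C !=set0 := cylinder_nonempty cY.
have HC g u : H g -> C (act g u) <-> C u by move=> Hg; exact: on_cylinder_stabilizer.
(* Any fixed vertex of the tree projects to one on the invariant subtree [Y]. *)
suff [q Hq] : exists q, forall g, H g -> act g q = q.
  have [p gp] := gate_ex treeT q C0; exists p; first exact: gp.1.
  move=> g Hg; have := gate_act (fun u => HC g u Hg) gp; rewrite Hq// => gp'.
  exact: gate_uniq cC gp' gp.
have [S [L [S0 GS cS edgesS]]] := cofinite_subtree treeT fgG.
(* If [Y] misses [S], the bridge between these two invariant subtrees provides a fixed vertex. *)
have [CS0|/set0P[x0 [Cx0 Sx0]]] := eqVneq (C `&` S) set0.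
  have [v fv] := bridge_fixed_point cC cS C0 S0 CS0.
  by exists v => g Hg; apply: fv => // u; exact: HC.
have sH : subgroup H := cylinder_stabilizer_subgroup Y.
have pairH h k : H h -> H k -> exists p, act h p = p /\ act k p = p.
  move=> Hh Hk; apply: (common_fixed_point treeT); apply: (cylinder_stabilizer_elliptic cY) => //.
  by apply: (subgroupM sH) => //; exact: (subgroupV sH).
have [//|far] := fixed_point_or_unbounded treeT x0 pairH.
(* The segment gets more edges than there are labels in [L]. *)
have [h Hh farh] := far (size L).+1.
have [q [Cq Sq] hq] : exists2 q, (C `&` S) q & act h q = q.
  apply: (fix_gate (treeT := treeT)); first exact: convexI.
  - by exists x0.
  - by move=> y; split=> -[/(HC _ _ Hh)Cy /GS Sy].
  - have [p hp] := cylinder_stabilizer_elliptic cY Hh; by exists p.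
have far_q := farh q hq; have [z [z0 zadj zE]] := iter_next treeT x0 q.
have zCS i : (i <= dist x0 q)%N -> (C `&` S) (z i).
  move=> lei; have [] := zE 0%N i; first by rewrite lei.
  rewrite z0 => E1 E2.
  by apply: (convex_between (convexI cC cS) (x := x0) (y := q)) => //; lia.
have zside i : (i < dist x0 q)%N -> side (z i) (z i.+1) q.
  move=> lti; rewrite /half_tree /=.
  by have [_ ->] := zE i i.+1 ltac:(lia); have [_ ->] := zE i i ltac:(lia); lia.
(* Labels each edge of the segment by the edge of [L] it translates; [(1, (x0, x0))] is a filler
   past the end. *)
have lab i : {ga : G * (T * T) | (i < dist x0 q)%N ->
    [/\ ga.2 \in L, z i = act ga.1 ga.2.1 & z i.+1 = act ga.1 ga.2.2]}.
  apply: cid; have [lti|] := boolP (i < dist x0 q)%N; last first.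
    by move=> _; exists (1, (x0, x0)).
  have [[_ Si] _] := (zCS i (ltnW lti), 0%N).
  have [g [a E]] := edgesS _ _ _ Si Sq (zadj i lti) (zside i lti).
  by exists (g, a).
have labL i : (i < (size L).+1)%N -> (index (sval (lab i)).2 L < size L)%N.
  by move=> lti; rewrite index_mem; case: (lab i) => ga /= []//; lia.
have [i [j [ij jL Fij]]] := pigeonhole labL.
have lti : (i < dist x0 q)%N by lia.
have ltj : (j < dist x0 q)%N by lia.
move: Fij; case: (lab i) => -[gi ai] /= /(_ lti)[aiL zi zi1].
case: (lab j) => -[gj aj] /= /(_ ltj)[ajL zj zj1] /(congr1 (nth (x0, x0) L)).
rewrite !nth_index// => aij; subst aj.
(* As the labels agree, [g] carries the edge at [i] to the edge at [j]; both are in [Y], so [g]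
   stabilizes [Y]. *)
pose g := gj * gi^-1.
have gzi : act g (z i) = z j by rewrite actM zi actK.
have gzi1 : act g (z i.+1) = z j.+1 by rewrite actM zi1 actK.
have edgeY m : (m < dist x0 q)%N -> Y [set z m; z m.+1].
  move=> ltm; have [Cm _] := zCS m (ltnW ltm).
  by apply: (cylinder_next cY Cm Cq (zadj m ltm)); exact: zside.
exfalso; apply: (cylinder_no_coherent (g := g) (x := z i) (y := z i.+1) cY).
- by apply/(cylinder_stabilizerP _ cY (edgeY i lti)); rewrite image_act_pair gzi gzi1; exact: edgeY.
- exact: edgeY.
- split; [exact: zadj| |]; rewrite gzi ?gzi1 /half_tree /=.
    have [-> _] := zE i.+1 j ltac:(lia); have [-> _] := zE i j ltac:(lia); lia.
  rewrite !(dist_sym treeT _ (z i)).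
  have [-> _] := zE i j.+1 ltac:(lia); have [-> _] := zE i j ltac:(lia); lia.
Qed.

End CylinderStabilizers.

(** * A criterion for acyclicity *)

Section Cuts.
Context {G : groupType} {T : ggraph G}.
Implicit Types (x y u v : T).
Local Open Scope classical_set_scope.

(* The edge [x -- y] is the only one leaving [P], at its end [y]. *)
Definition cut (P : set T) x y : Prop :=
  [/\ P y, ~ P x & forall u v, adj T u v -> P u -> ~ P v -> u = y /\ v = x].

Lemma cutC P x y : cut P x y -> cut (~` P) y x.
Proof.
move=> [Py nPx cP]; split; [exact: nPx|exact|].
move=> u v uv nPu /contrapT Pv; rewrite adj_sym in uv.
by have [-> ->] := cP v u uv Pv nPu.
Qed.

(** A cycle starting with [x], [y] stays in [P] after [y] until it returns to [x]; its last step
    leaves [P], hence starts at [y], which is then repeated. *)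
Lemma acyclic_cut : (forall x y, adj T x y -> exists P, cut P x y) ->
  forall c : seq T, (2 < size c)%N -> ~ ucycle (adj T) c.
Proof.
move=> cuts [|x [|y [|z q]]] //= _ /andP[/= /and3P[xy yz zq]].
rewrite !inE !negb_or => /and4P[/and3P[_ xz _] yq _ _].
have [P [Py nPx cP]] := cuts x y xy.
have Pz : P z.
  by apply: contrapT => nPz; have [_ zx] := cP y z yz Py nPz; rewrite zx eqxx in xz.
move: yq; rewrite -negb_or -in_cons.
elim: q z zq Pz {yz xz} => [|a q IHq] z /=; rewrite ?andbT.
  by move=> zx Pz; have [-> _] := cP z x zx Pz nPx; rewrite inE eqxx.
move=> /andP[za aq] Pz; rewrite in_cons negb_or => /andP[yz yq].
apply: (IHq a) => //; apply: contrapT => nPa.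
by have [zy _] := cP z a za Pz nPa; rewrite zy eqxx in yz.
Qed.

End Cuts.

(** * Collapsing edges of a tree yields a tree *)

Section CollapseTree.
Context {G : groupType} {T : ggraph G}.
Hypothesis treeT : is_tree T.
Implicit Types (x y z u v : T) (g h : G) (C D : collapse T).
Local Open Scope classical_set_scope.
Local Open Scope group_scope.
Local Notation side := (half_tree treeT).

Lemma collapsed_sym : symmetric (@collapsed G T).
Proof. by move=> x y; rewrite /collapsed adj_sym setUC. Qed.

Definition component_vertex x : collapse T :=
  exist (fun A => `[< is_component A >]) (component x)
    (asboolT (ex_intro _ x erefl)).

Lemma mem_component x : val (component_vertex x) x.
Proof. exact: joined_refl. Qed.

Lemma mem_componentP C x y : val C x -> val C y <-> joined (@collapsed G T) x y.
Proof.
have [z ->] := asboolW (valP C) => zx; split=> [zy|]; last exact: joined_trans.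
exact: joined_trans (joined_sym collapsed_sym zx) zy.
Qed.

Lemma component_uniq C D x : val C x -> val D x -> C = D.
Proof.
move=> Cx Dx; apply: val_inj; apply/seteqP.
by split=> y; rewrite (mem_componentP y Cx) (mem_componentP y Dx).
Qed.

Lemma component_nonempty C : exists x, val C x.
Proof. by have [z ->] := asboolW (valP C); exists z; exact: joined_refl. Qed.

Lemma collapsed_component C D x y : collapsed x y -> val C x -> val D y -> C = D.
Proof.
move=> xy Cx; apply: component_uniq; apply/(mem_componentP _ Cx).
exact: joined_step.
Qed.

Lemma collapse_adjP C D :
  adj (collapse T) C D <-> C <> D /\ exists x y, [/\ val C x, val D y & adj T x y].
Proof.
split=> [/andP[/eqP CD /asboolP]|[/eqP CD ?]] //.
by apply/andP; split=> //; exact/asboolP.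
Qed.

(** A path of collapsed edges from [u] to [v] has to cross [x -- y], the only edge between its two
    half-trees. *)
Lemma component_straddle C x y u v : adj T x y -> val C u -> val C v ->
  side x y u -> ~ side x y v -> collapsed x y.
Proof.
move=> xy Cu Cv hu hv; have uv := (mem_componentP v Cu).1 Cv.
have [a [b [ab ha hb]]] := joined_cross uv hu hv.
have [ab_adj _] := andP ab.
have [Ea Eb] := side_cross xy ab_adj ha hb.
by rewrite -Ea -Eb collapsed_sym.
Qed.

(** As [x -- y] is not collapsed, neither component straddles it, so every edge from [C] to [D]
    crosses between its half-trees. *)
Lemma collapse_edge_uniq C D x y x' y' : C <> D ->
  val C x -> val D y -> adj T x y -> val C x' -> val D y' -> adj T x' y' ->
  x' = x /\ y' = y.
Proof.
move=> CD Cx Dy xy Cx' Dy' x'y'.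
have ncxy : ~ collapsed x y by move=> cxy; apply: CD; exact: collapsed_component cxy Cx Dy.
have hx' : ~ side x y x'.
  by move=> hx'; apply: ncxy; exact: component_straddle xy Cx' Cx hx' (@side_start _ _ treeT x y).
have hy' : side x y y'.
  apply: contrapT => hy'; apply: ncxy.
  exact: component_straddle xy Dy Dy' (side_end treeT xy) hy'.
have y'x' : adj T y' x' by rewrite adj_sym.
by have [] := side_cross xy y'x' hy' hx'.
Qed.

Lemma collapse_fixed_edge C D x y g : C <> D -> val C x -> val D y -> adj T x y ->
  act g C = C -> act g D = D -> act g x = x /\ act g y = y.
Proof.
move=> CD Cx Dy xy gC gD; apply: (collapse_edge_uniq CD Cx Dy xy).
- by rewrite -gC; exists x.
- by rewrite -gD; exists y.
- by rewrite act_adj.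
Qed.

(** The components on the side of [y] form the cut, since none straddles the uncollapsed edge
    [x -- y]. *)
Lemma collapse_cut C D : adj (collapse T) C D -> exists P, cut P C D.
Proof.
move=> /collapse_adjP[CD [x [y [Cx Dy xy]]]].
have ncxy : ~ collapsed x y by move=> cxy; apply: CD; exact: collapsed_component cxy Cx Dy.
exists [set E : collapse T | exists2 z, val E z & side x y z]; split.
- by exists y => //; exact: side_end.
- move=> [z Cz hz]; apply: ncxy.
  exact: component_straddle xy Cz Cx hz (@side_start _ _ treeT x y).
move=> E F /collapse_adjP[EF [u [v [Eu Fv uv]]]] [z Ez hz] nF.
have hv : ~ side x y v by move=> hv; apply: nF; exists v.
have hu : side x y u.
  by apply: contrapT => hu; apply: ncxy; exact: component_straddle xy Ez Eu hz hu.
have [uy vx] := side_cross xy uv hu hv; rewrite uy in Eu; rewrite vx in Fv.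
by split; [exact: component_uniq Eu Dy|exact: component_uniq Fv Cx].
Qed.

Lemma collapse_tree : is_tree (collapse T).
Proof.
have [[x0] conn _ noinv] := treeT; split.
- by split; exact: component_vertex x0.
- move=> C D; have [x Cx] := component_nonempty C; have [y Dy] := component_nonempty D.
  rewrite -(component_uniq (mem_component x) Cx) -(component_uniq (mem_component y) Dy).
  have : joined (adj T) x y by exact: conn.
  move: y {Dy}; apply: (joined_ind (P := fun y => joined (adj (collapse T))
    (component_vertex x) (component_vertex y))); first exact: joined_refl.
  move=> u v _ IH uv.
  have [<- //|uvN] := pselect (component_vertex u = component_vertex v).
  apply: (joined_trans IH); apply: joined_step; apply/collapse_adjP; split=> //.
  by exists u, v; split=> //; exact: mem_component.
- by apply: acyclic_cut => C D; exact: collapse_cut.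
- move=> g C D /collapse_adjP[CD [x [y [Cx Dy xy]]]] [gC gD].
  apply: (noinv g x y xy).
  have [] : act g y = x /\ act g x = y; last by [].
  apply: (collapse_edge_uniq CD Cx Dy xy).
  + by rewrite -gD; exists y.
  + by rewrite -gC; exists x.
  + by rewrite adj_sym act_adj.
Qed.

End CollapseTree.

(** * The tree of cylinders and its edge stabilizers *)

Section TreeOfCylinders.
Context {G : groupType} {T : ggraph G}.
Hypothesis treeT : is_tree T.
Hypothesis cyclic_edges : forall e : set T, edge T e -> infinite_cyclic (fixer e).
Implicit Types (x y z u v p : T) (g h : G) (e : set T) (Y Z : set (set T)).
Local Open Scope classical_set_scope.
Local Open Scope group_scope.
Local Notation Tc := (tree_of_cylinders T).
Local Notation side := (half_tree treeT).

Definition point_vertex x (Vx : V0 x) : Tc :=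
  inl (exist (fun x => `[< V0 x >]) x (asboolT Vx)).

Definition cylinder_vertex Y (cY : cylinder Y) : Tc :=
  inr (exist (fun Y => `[< cylinder Y >]) Y (asboolT cY)).

(** A case view that exposes propositional membership proofs instead of the boolean ones stored in
    the subtypes. *)
Variant Tc_spec : Tc -> Type :=
| Tc_point x (Vx : V0 x) : Tc_spec (point_vertex Vx)
| Tc_cylinder Y (cY : cylinder Y) : Tc_spec (cylinder_vertex cY).

Lemma TcP (a : Tc) : Tc_spec a.
Proof.
case: a => [[x Vx]|[Y cY]].
  suff -> : inl (exist _ x Vx) = point_vertex (asboolW Vx) by constructor.
  by congr inl; exact: val_inj.
suff -> : inr (exist _ Y cY) = cylinder_vertex (asboolW cY) by constructor.
by congr inr; exact: val_inj.
Qed.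

Lemma point_vertex_eq x y (Vx : V0 x) (Vy : V0 y) :
  point_vertex Vx = point_vertex Vy <-> x = y.
Proof.
split=> [E|xy]; last by congr inl; exact: val_inj.
by have := congr1 (fun a : Tc => if a is inl z then val z else x) E.
Qed.

Lemma cylinder_vertex_eq Y Z (cY : cylinder Y) (cZ : cylinder Z) :
  cylinder_vertex cY = cylinder_vertex cZ <-> Y = Z.
Proof.
split=> [E|YZ]; last by congr inr; exact: val_inj.
by have := congr1 (fun a : Tc => if a is inr W then val W else Y) E.
Qed.

Lemma act_point_vertex g x (Vx : V0 x) :
  act g (point_vertex Vx) = point_vertex (V0_act g Vx).
Proof. by congr inl; exact: val_inj. Qed.

Lemma act_cylinder_vertex g Y (cY : cylinder Y) :
  act g (cylinder_vertex cY) = cylinder_vertex (cylinder_act g cY).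
Proof. by congr inr; exact: val_inj. Qed.

Lemma fixed_point_vertex g x (Vx : V0 x) :
  act g (point_vertex Vx) = point_vertex Vx <-> act g x = x.
Proof. by rewrite act_point_vertex; exact: point_vertex_eq. Qed.

Lemma fixed_cylinder_vertex g Y (cY : cylinder Y) :
  act g (cylinder_vertex cY) = cylinder_vertex cY <-> cylinder_stabilizer Y g.
Proof. by rewrite act_cylinder_vertex; exact: cylinder_vertex_eq. Qed.

Lemma adj_point_cylinder x Y (Vx : V0 x) (cY : cylinder Y) :
  adj Tc (point_vertex Vx) (cylinder_vertex cY) <-> on_cylinder x Y.
Proof. by split=> [/asboolP|H] //; exact/asboolP. Qed.

(** The cut consists of what lies beyond [x] through an edge of [Y], together with [Y]. A cylinder
    with vertices both ahead and not ahead contains an edge of [Y] at [x] by convexity, so it is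
    [Y]; and the only vertex of [Y] not ahead is [x]. *)
Lemma tree_of_cylinders_cut x Y (Vx : V0 x) (cY : cylinder Y) : on_cylinder x Y ->
  exists P, cut P (point_vertex Vx) (cylinder_vertex cY).
Proof.
move=> xY.
pose ahead z := exists y, [/\ adj T x y, Y [set x; y] & side x y z].
exists [set a : Tc | match a with
  | inl z => ahead (val z)
  | inr Z => val Z = Y \/ exists2 z, on_cylinder z (val Z) & ahead z end]; split.
- by left.
- by move=> [y [_ _]]; exact: side_start.
move=> a b; case: (TcP a) => [z Vz|Z cZ]; case: (TcP b) => [z' Vz'|Z' cZ'] //=.
  by move=> /asboolP zZ' za []; right; exists z.
move=> /asboolP z'Z Za nz'.
have z'x : Z = Y -> z' = x.
  move=> ZY; rewrite /= ZY in z'Z; apply: contrapT => /nesym xz'.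
  have [y xy Ey] := dist_next treeT xz'.
  have hz' : side x y z' by rewrite /half_tree /=; lia.
  by apply: nz'; exists y; split=> //; exact: cylinder_next xY z'Z xy hz'.
have [ZY|[z zZ [y [xy Yxy hz]]]] := Za.
  by split; [exact/cylinder_vertex_eq|apply/point_vertex_eq; exact: z'x].
have hz' : ~ side x y z' by move=> hz'; apply: nz'; exists y.
have [xZ yZ] := convex_cross (cylinder_convex (treeT := treeT) cyclic_edges cZ) xy zZ z'Z hz hz'.
have Zxy := cylinder_next cyclic_edges cZ xZ yZ xy (side_end treeT xy).
have ZY := cylinder_uniq cyclic_edges cZ cY Zxy Yxy.
by split; [exact/cylinder_vertex_eq|apply/point_vertex_eq; exact: z'x].
Qed.

Lemma exists_cylinder x : ~ (forall y, y = x) -> exists2 Y, cylinder Y & on_cylinder x Y.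
Proof.
move=> /existsNP[y /nesym xy]; have [z xz _] := dist_next treeT xy.
exists (edge_class [set x; z]); first exact/cylinder_edge_class/edge_pair.
by exists [set x; z]; [apply: mem_edge_class => //; exact: edge_pair|left].
Qed.

(** Follows a path of [T]: the cylinders of consecutive edges share a vertex, which is in [V0] if
    they differ. *)
Lemma joined_cylinders u v Y Z (cY : cylinder Y) (cZ : cylinder Z) :
  on_cylinder u Y -> on_cylinder v Z ->
  joined (adj Tc) (cylinder_vertex cY) (cylinder_vertex cZ).
Proof.
have same w W W' (cW : cylinder W) (cW' : cylinder W') :
    on_cylinder w W -> on_cylinder w W' ->
    joined (adj Tc) (cylinder_vertex cW) (cylinder_vertex cW').
  move=> wW wW'; have [/cylinder_vertex_eq -> //|WW'] := pselect (W = W').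
    exact: joined_refl.
  have Vw : V0 w by left; exists W, W'.
  apply: (joined_trans (y := point_vertex Vw)); apply: joined_step.
    by rewrite adj_sym; apply/adj_point_cylinder.
  exact/adj_point_cylinder.
move=> uY vZ; have [_ conn _ _] := treeT.
have uv : joined (adj T) u v by exact: conn.
move: v uv Z cZ vZ; apply: (joined_ind (P := fun v => forall Z (cZ : cylinder Z),
  on_cylinder v Z -> joined (adj Tc) (cylinder_vertex cY) (cylinder_vertex cZ))).
  by move=> Z cZ uZ; exact: same uY uZ.
move=> w z _ IH wz Z cZ zZ.
have cW := cylinder_edge_class (edge_pair wz).
have Wwz := mem_edge_class cyclic_edges (edge_pair wz).
apply: (joined_trans (y := cylinder_vertex cW)).
  by apply: IH; exists [set w; z] => //; left.
by apply: (same z) => //; exists [set w; z] => //; right.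
Qed.

Lemma tree_of_cylinders_tree : is_tree Tc.
Proof.
have [[x0] _ _ _] := treeT.
have [ptT|npt] := pselect (forall y, y = x0).
  have aE (a b : Tc) : a = b.
    have nocyl Y : cylinder Y -> False.
      by move=> [_ [x [y [xy _]]] _]; apply: (adj_neq xy); rewrite (ptT x) (ptT y).
    case: (TcP a) => [x Vx|Y /nocyl //]; case: (TcP b) => [y Vy|Y /nocyl //].
    by apply/point_vertex_eq; rewrite (ptT x) (ptT y).
  have noadj (a b : Tc) : ~ adj Tc a b by rewrite (aE a b) adj_irr.
  split.
  - by split; apply: (@point_vertex x0); right.
  - by move=> a b; exists [::] => //=; exact: aE.
  - by move=> [|a [|b c]] // _ /andP[/= /andP[/noadj]].
  - by move=> g a b /noadj.
have toY (a : Tc) : exists u Y (cY : cylinder Y), on_cylinder u Y /\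
    joined (adj Tc) a (cylinder_vertex cY).
  case: (TcP a) => [x Vx|Y cY].
    have [|Y cY xY] := @exists_cylinder x.
      by move=> xT; apply: npt => y; rewrite (xT y) (xT x0).
    exists x, Y, cY; split=> //; apply: joined_step; exact/adj_point_cylinder.
  have [u uY] := cylinder_nonempty cyclic_edges cY.
  by exists u, Y, cY; split=> //; exact: joined_refl.
split.
- have [Y cY _] := exists_cylinder npt; split; exact: (cylinder_vertex cY).
- move=> a b; have [u [Y [cY [uY aY]]]] := toY a; have [v [Z [cZ [vZ bZ]]]] := toY b.
  apply: (joined_trans aY); apply: (joined_trans (joined_cylinders cY cZ uY vZ)).
  by apply: joined_sym bZ; exact: adj_sym.
- apply: acyclic_cut => a b; case: (TcP a) => [x Vx|Y cY]; case: (TcP b) => [y Vy|Z cZ] //.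
    by move=> /adj_point_cylinder; exact: tree_of_cylinders_cut.
  rewrite adj_sym => /adj_point_cylinder /(tree_of_cylinders_cut Vy cY)[P cP].
  by exists (~` P); exact: cutC.
- by move=> g a b; case: (TcP a) => [x Vx|Y cY]; case: (TcP b) => [y Vy|Z cZ] // _ [].
Qed.

Lemma fixer_image (A : set T) g : fixer A g -> act g @` A = A.
Proof.
by move=> fA; apply/seteqP; split=> [_ [x Ax <-]|x Ax]; [rewrite fA|exists x => //; exact: fA].
Qed.

Lemma fixer_edge_stabilizer Y e g : cylinder Y -> Y e -> fixer e g ->
  cylinder_stabilizer Y g.
Proof.
move=> cY Ye fe; apply/(cylinder_stabilizerP cyclic_edges _ cY Ye).
by rewrite fixer_image.
Qed.

Lemma fixer_Tc_edge x Y (Vx : V0 x) (cY : cylinder Y) g :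
  fixer [set point_vertex Vx; cylinder_vertex cY] g <->
  act g x = x /\ cylinder_stabilizer Y g.
Proof. by rewrite fixer_pair fixed_point_vertex fixed_cylinder_vertex. Qed.

(** If [x] differs from [p], the stabilizer of [(x, Y)] fixes [p], so it equals that of the first
    edge from [x] towards [p], which is infinite cyclic; then [(x, Y)] is not collapsed. *)
Lemma collapsed_fixed_point x Y (Vx : V0 x) (cY : cylinder Y) p :
  on_cylinder p Y -> (forall g, cylinder_stabilizer Y g -> act g p = p) ->
  collapsed (point_vertex Vx) (cylinder_vertex cY) -> x = p.
Proof.
move=> pY fp /andP[/adj_point_cylinder xY /asboolP ncyc]; apply: contrapT => xp.
have [y xy Ey] := dist_next treeT xp.
have hp : side x y p by rewrite /half_tree /=; lia.
have Yxy := cylinder_next cyclic_edges cY xY pY xy hp.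
apply: ncyc; suff -> : fixer [set point_vertex Vx; cylinder_vertex cY] = fixer [set x; y].
  exact/cyclic_edges/edge_pair.
apply/seteqP; split=> g.
  move=> /fixer_Tc_edge[gx /fp gp]; apply/fixer_pair; split=> //.
  exact: (@fix_convex _ _ treeT g x p y).
move=> fg; apply/fixer_Tc_edge; split; first by apply: fg; left.
exact: fixer_edge_stabilizer Yxy fg.
Qed.

(** The stabilizer of an edge of [Y] at [x] fixes [x] and preserves [Y], so the two infinite cyclic
    groups share a non-trivial element. *)
Lemma noncollapsed_commensurable x Y (Vx : V0 x) (cY : cylinder Y) :
  adj Tc (point_vertex Vx) (cylinder_vertex cY) ->
  ~ collapsed (point_vertex Vx) (cylinder_vertex cY) ->
  infinite_cyclic (fixer [set point_vertex Vx; cylinder_vertex cY]) /\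
  exists2 e, Y e & commensurable (fixer [set point_vertex Vx; cylinder_vertex cY]) (fixer e).
Proof.
move=> xY nc.
have icF : infinite_cyclic (fixer [set point_vertex Vx; cylinder_vertex cY]).
  by apply: contrapT => nic; apply: nc; rewrite /collapsed xY; exact/asboolP.
split=> //; have [e Ye ex] := (adj_point_cylinder _ _).1 xY.
have ice := cyclic_edges (cylinder_edge cY Ye).
exists e => //; apply/commensurable_infinite_cyclic => //.
have [w w1 we] := infinite_cyclic_neq1 ice; exists w; split=> //.
by apply/fixer_Tc_edge; split; [exact: we|exact: fixer_edge_stabilizer Ye we].
Qed.

Lemma noncollapsed_fixed_uniq x x' Y Y' (Vx : V0 x) (Vx' : V0 x')
    (cY : cylinder Y) (cY' : cylinder Y') g :
  adj Tc (point_vertex Vx) (cylinder_vertex cY) ->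
  ~ collapsed (point_vertex Vx) (cylinder_vertex cY) ->
  adj Tc (point_vertex Vx') (cylinder_vertex cY') ->
  ~ collapsed (point_vertex Vx') (cylinder_vertex cY') ->
  g <> 1 ->
  fixer [set point_vertex Vx; cylinder_vertex cY] g ->
  fixer [set point_vertex Vx'; cylinder_vertex cY'] g -> Y = Y'.
Proof.
move=> xY nc xY' nc' g1 fg fg'.
have [ic [e Ye ce]] := noncollapsed_commensurable xY nc.
have [ic' [e' Ye' ce']] := noncollapsed_commensurable xY' nc'.
have ee' := cylinder_edge cY' Ye'; have ee := cylinder_edge cY Ye.
apply: (cylinder_uniq cyclic_edges cY cY' _ Ye').
rewrite (cylinderE cyclic_edges cY Ye); split=> //.
have [ice ice'] := (cyclic_edges ee, cyclic_edges ee').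
apply: (commensurable_trans ice ic ice' (commensurable_sym ce)).
apply: (commensurable_trans ic ic' ice' _ ce').
by apply/commensurable_infinite_cyclic => //; exists g.
Qed.

End TreeOfCylinders.

(** * Comparison of elliptic subgroups, and acylindricity *)

Section Main.
Context {G : groupType} {T : ggraph G}.
Hypothesis treeT : is_tree T.
Hypothesis cyclic_edges : forall e : set T, edge T e -> infinite_cyclic (fixer e).
Implicit Types (x y z u v p : T) (g h : G) (H : set G) (Y Z : set (set T)).
Local Open Scope classical_set_scope.
Local Open Scope group_scope.
Local Notation Tc := (tree_of_cylinders T).

Lemma ellipticP (T' : ggraph G) H :
  elliptic T' H <-> exists a : T', forall g, H g -> act g a = a.
Proof.
split=> [[a Ha]|[a Ha]]; exists a; first by move=> g /Ha; apply.
by move=> g Hg _ ->; exact: Ha.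
Qed.

(** If the fixed vertex [x] is not in [V0], only one cylinder contains it, and elements fixing [x]
    preserve this cylinder. *)
Lemma elliptic_tree_of_cylinders H : elliptic T H -> elliptic Tc H.
Proof.
move=> /ellipticP[x Hx]; apply/ellipticP.
have [Vx|nVx] := pselect (V0 x).
  by exists (point_vertex Vx) => g /Hx gx; exact/fixed_point_vertex.
have [|Y cY xY] := exists_cylinder treeT cyclic_edges (x := x).
  by move=> xT; apply: nVx; right.
exists (cylinder_vertex cY) => g /Hx gx; apply/fixed_cylinder_vertex.
apply: contrapT => gY; apply: nVx; left; exists (act_sets g Y), Y; split=> //.
- exact: cylinder_act.
- by rewrite -gx; exact: on_cylinder_act.
Qed.

Lemma elliptic_collapse (T' : ggraph G) H : elliptic T' H -> elliptic (collapse T') H.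
Proof.
move=> /ellipticP[a Ha]; apply/ellipticP; exists (component_vertex a) => g /Ha ga.
apply: val_inj; change (act g @` component a = component a).
by rewrite component_act ga.
Qed.

(** On a segment [A], [B], [C], [D] fixed by [g <> 1], the edges [A -- B] and [C -- D] come from
    uncollapsed edges fixed by [g], hence with the same cylinder. Its vertex would lie in one of
    [A], [B] and in one of [C], [D], which are distinct components. *)
Lemma collapsed_tree_acylindrical : acylindrical 2 (collapsed_tree_of_cylinders T).
Proof.
have treeTc := tree_of_cylinders_tree treeT cyclic_edges.
move=> A [|B [|C [|D p]]] // path_p uniq_p _.
apply/seteqP; split=> [g fg|_ -> E _]; last exact: act1.
apply: contrapT => g1; move: path_p => /= /and4P[AB BC CD _].
have fix_mem E : E \in A :: B :: C :: D :: p -> act g E = E by exact: fg.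
have edge_cyl E F : adj (collapsed_tree_of_cylinders T) E F ->
    act g E = E -> act g F = F ->
  exists x Y (Vx : V0 x) (cY : cylinder Y), [/\
    val E (cylinder_vertex cY) \/ val F (cylinder_vertex cY),
    adj Tc (point_vertex Vx) (cylinder_vertex cY),
    ~ collapsed (point_vertex Vx) (cylinder_vertex cY) &
    fixer [set point_vertex Vx; cylinder_vertex cY] g].
  move=> /collapse_adjP[EF [a [b [Ea Fb ab]]]] gE gF.
  have [ga gb] := collapse_fixed_edge treeTc EF Ea Fb ab gE gF.
  have nc : ~ collapsed a b by move=> c; apply: EF; exact: collapsed_component c Ea Fb.
  move: Ea Fb ab ga gb nc; case: (TcP a) => [x Vx|Y cY]; case: (TcP b) => [y Vy|Z cZ] //.
    move=> Ea Fb ab ga gb nc; exists x, Z, Vx, cZ; split=> //; first by right.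
    exact/fixer_pair.
  rewrite adj_sym collapsed_sym => Ea Fb ab ga gb nc.
  exists y, Y, Vy, cY; split=> //; first by left.
  exact/fixer_pair.
have [x [Y [Vx [cY [ABY xY nc fxY]]]]] : _ := edge_cyl A B AB
  (fix_mem A ltac:(by rewrite !inE eqxx)) (fix_mem B ltac:(by rewrite !inE eqxx !orbT)).
have [x' [Y' [Vx' [cY' [CDY xY' nc' fxY']]]]] : _ := edge_cyl C D CD
  (fix_mem C ltac:(by rewrite !inE eqxx !orbT)) (fix_mem D ltac:(by rewrite !inE eqxx !orbT)).
have YY' := noncollapsed_fixed_uniq cyclic_edges xY nc xY' nc' g1 fxY fxY'.
have EY := (cylinder_vertex_eq cY cY').2 YY'; rewrite -EY in CDY.
move: uniq_p; rewrite !cons_uniq !in_cons.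
move=> /and4P[/norP[_ /norP[AC /norP[AD _]]] /norP[BC' /norP[BD _]] _ _].
by case: ABY CDY => E1 [] E2; move: AC AD BC' BD;
  rewrite (component_uniq E1 E2) eqxx.
Qed.

Hypothesis fgG : finitely_generated G.
Hypothesis CT : commutative_transitive G.
Hypothesis BS_elliptic : forall K : set G, solvable_BS_subgroup K -> elliptic T K.

Lemma tree_of_cylinders_elliptic H : elliptic Tc H -> elliptic T H.
Proof.
move=> /ellipticP[a]; case: (TcP a) => [x Vx|Y cY] Ha; apply/ellipticP.
  by exists x => g /Ha /fixed_point_vertex.
have [p _ fp] := cylinder_fixed_point treeT cyclic_edges CT BS_elliptic fgG cY.
by exists p => g /Ha /fixed_cylinder_vertex; exact: fp.
Qed.

(* A collapsed edge [(x, Y)] has [x] equal to the vertex fixed by the stabilizer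
   of [Y], so a component is a star around its only vertex of [V0], or a single
   cylinder. *)
Lemma component_point_uniq (C : collapse Tc) x y (Vx : V0 x) (Vy : V0 y) :
  val C (point_vertex Vx) -> val C (point_vertex Vy) -> x = y.
Proof.
move=> Cx /(mem_componentP _ Cx).
pose P (a : Tc) := match a with
  | inl z => x = val z
  | inr _ => collapsed (point_vertex Vx) a end.
move=> /(joined_ind (P := P)); apply=> // a b _.
case: (TcP a) => [z Vz|Y cY]; case: (TcP b) => [z' Vz'|Z cZ] //=.
- by move=> xz; rewrite ((point_vertex_eq Vx Vz).2 xz).
- rewrite (collapsed_sym (cylinder_vertex cY)) => xY z'Y.
  have [p pY fp] := cylinder_fixed_point treeT cyclic_edges CT BS_elliptic fgG cY.
  rewrite (collapsed_fixed_point treeT cyclic_edges pY fp xY).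
  by rewrite (collapsed_fixed_point treeT cyclic_edges pY fp z'Y).
Qed.

(** An invariant component either has a unique vertex from [V0], which is then fixed, or is a single
    cylinder vertex, since no two cylinder vertices are adjacent. *)
Lemma collapse_elliptic H : elliptic (collapse Tc) H -> elliptic Tc H.
Proof.
move=> /ellipticP[C HC]; apply/ellipticP.
have HCa g a : H g -> val C a -> val C (act g a).
  by move=> Hg Ca; rewrite -[C](HC g Hg); exists a.
have [[x [Vx Cx]]|nopt] := pselect (exists x (Vx : V0 x), val C (point_vertex Vx)).
  exists (point_vertex Vx) => g Hg; apply/fixed_point_vertex.
  have := HCa g _ Hg Cx; rewrite act_point_vertex => Cgx.
  exact: component_point_uniq Cgx Cx.
have [a Ca] := component_nonempty C; exists a => g Hg.
have := (mem_componentP _ Ca).1 (HCa g a Hg Ca); move: (act g a) => b.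
move=> /(joined_ind (P := fun b => b = a)); apply=> // c d ac -> ad.
have Cd : val C d by apply/(mem_componentP _ Ca); exact: joined_step.
move: Ca Cd ad; case: (TcP a) => [x Vx Cx|Y cY _]; first by case: nopt; exists x, Vx.
case: (TcP d) => [x Vx Cx|Z cZ _]; first by case: nopt; exists x, Vx.
by move=> /andP[].
Qed.

End Main.

Theorem theorem3 (G : groupType) (T : ggraph G) :
  finitely_generated G ->
  torsion_free G ->
  commutative_transitive G ->
  is_tree T ->
  (forall e : set T, edge T e -> infinite_cyclic (fixer e)) ->
  (forall K : set G, solvable_BS_subgroup K -> elliptic T K) ->
  [/\ same_deformation_space (collapsed_tree_of_cylinders T)
        (tree_of_cylinders T),
      same_deformation_space (tree_of_cylinders T) T
    & acylindrical 2 (collapsed_tree_of_cylinders T)].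
Proof.
move=> fgG _ CT treeT cyclic_edges BS_elliptic.
have treeTc := tree_of_cylinders_tree treeT cyclic_edges.
split; last exact: collapsed_tree_acylindrical.
- split=> //; first exact: collapse_tree.
  by move=> H _; split; [exact: collapse_elliptic|exact: elliptic_collapse].
- split=> // H _; split; first exact: tree_of_cylinders_elliptic.
  exact: elliptic_tree_of_cylinders.
Qed.
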